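(* Let $q\in\mathbb{C}$ with $|q|=1$, let $X=\{X_{(m,n)}\}_{(m,n)\in\mathbb{Z}^2}$ be a family of lower triangular matrices $X_{(m,n)}=\begin{pmatrix} a_{(m,n)} & 0\\ c_{(m,n)} & d_{(m,n)}\end{pmatrix}\in \mathrm{SL}_2(\mathbb{C})$, and assume that $\mu$ is a real number. Then there exists a hermitian form $(\cdot,\cdot)$ on $V$ which is contravariant with respect to $\pi_{X,\mu}$ and $\omega$, i.e. $(1,1)=1$ and $$(\pi_{X,\mu}(a).f,\,g)=(f,\,\pi_{X,\mu}(\omega(a)).g)$$ for all $f,g\in V$ and $a\in\widetilde{\mathfrak{gl}_2(\mathbb{C}_q)}$.
   Context: Quantum torus: $\mathbb{C}_q$ is the unital associative $\mathbb{C}$-algebra generated by $s^{\pm1},t^{\pm1}$ with relations $ss^{-1}=s^{-1}s=tt^{-1}=t^{-1}t=1$, $ts=q\,st$; it has $\mathbb{C}$-basis $s^mt^n$, $(m,n)\in\mathbb{Z}^2$, and $(s^{m_1}t^{n_1})(s^{m_2}t^{n_2})=q^{n_1m_2}s^{m_1+m_2}t^{n_1+n_2}$. Lie algebra: $E_{ij}$ is the $2\times2$ matrix unit, and $E_{ij}(x)$ ($x\in\mathbb{C}_q$) is the matrix in $M_2(\mathbb{C}_q)$ with $(i,j)$ entry $x$ and other entries $0$. As a vector space $\widetilde{\mathfrak{gl}_2(\mathbb{C}_q)}=M_2(\mathbb{C}_q)\oplus\mathbb{C}c_s\oplus\mathbb{C}c_t\oplus\mathbb{C}d_s\oplus\mathbb{C}d_t$;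 the bracket is determined by: $c_s,c_t$ are central, $[d_s,d_t]=0$, $[d_s,E_{ij}(s^mt^n)]=mE_{ij}(s^mt^n)$, $[d_t,E_{ij}(s^mt^n)]=nE_{ij}(s^mt^n)$, and $$[E_{ij}(s^{m_1}t^{n_1}),E_{kl}(s^{m_2}t^{n_2})]=\delta_{jk}q^{n_1m_2}E_{il}(s^{m_1+m_2}t^{n_1+n_2})-\delta_{il}q^{n_2m_1}E_{kj}(s^{m_1+m_2}t^{n_1+n_2})+\delta_{jk}\delta_{il}\delta_{m_1+m_2,0}\delta_{n_1+n_2,0}\,q^{n_1m_2}(m_1c_s+n_1c_t).$$ Anti-involution: let $\bar{\ }:\mathbb{C}_q\to\mathbb{C}_q$ be the $\mathbb{R}$-linear map with $\overline{\lambda s^mt^n}=\bar\lambda\, t^{-n}s^{-m}=\bar\lambda q^{mn}s^{-m}t^{-n}$ ($\bar\lambda$ the complex conjugate). The antilinear map $\omega$ on $\widetilde{\mathfrak{gl}_2(\mathbb{C}_q)}$ (i.e. $\mathbb{R}$-linear with $\omega(\lambda x)=\bar\lambda\omega(x)$) is given by $\omega(E_{ij}(a))=(-1)^{i+j}E_{ji}(\bar a)$ for $a\in\mathbb{C}_q$, $\omega(d_s)=d_s$, $\omega(d_t)=d_t$, $\omega(c_s)=c_s$, $\omega(c_t)=c_t$. Representation: $V=\mathbb{C}[x_{(m,n)}:(m,n)\in\mathbb{Z}^2]$ is the commutative polynomial ring. For $A\in\mathbb{Z}^2$ define operators on $V$: $P_A=a_A\frac{\partial}{\partial x_A}$, $Q_A=c_A\frac{\partial}{\partial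 x_A}+d_Ax_A$ (where $x_A$ acts by multiplication). For $m_1,n_1\in\mathbb{Z}$ put $$e_{12}(m_1,n_1)=-q^{-m_1n_1}\mu P_{(-m_1,-n_1)}-\sum_{(m,n),(m',n')\in\mathbb{Z}^2}q^{n_1m'+nm_1+nm'}Q_{(m+m'+m_1,\,n+n'+n_1)}P_{(m,n)}P_{(m',n')},$$ $$e_{21}(m_1,n_1)=Q_{(m_1,n_1)},$$ $$e_{11}(m_1,n_1)=-\sum_{(m,n)\in\mathbb{Z}^2}q^{nm_1}Q_{(m+m_1,n+n_1)}P_{(m,n)}-\tfrac12\mu\,\delta_{(m_1,n_1),(0,0)},$$ $$e_{22}(m_1,n_1)=\sum_{(m,n)\in\mathbb{Z}^2}q^{mn_1}Q_{(m+m_1,n+n_1)}P_{(m,n)}+\tfrac12\mu\,\delta_{(m_1,n_1),(0,0)},$$ $$D_1=\sum_{(m,n)\in\mathbb{Z}^2}m\,Q_{(m,n)}P_{(m,n)},\qquad D_2=\sum_{(m,n)\in\mathbb{Z}^2}n\,Q_{(m,n)}P_{(m,n)}$$ (only finitely many terms are nonzero on any given polynomial). The Lie algebra representation $\pi_{X,\mu}:\widetilde{\mathfrak{gl}_2(\mathbb{C}_q)}\to\mathrm{End}\,V$ is the linear map with $\pi_{X,\mu}(E_{ij}(s^{m}t^{n}))=e_{ij}(m,n)$, $\pi_{X,\mu}(d_s)=D_1$, $\pi_{X,\mu}(d_t)=D_2$, $\pi_{X,\mu}(c_s)=\pi_{X,\mu}(c_t)=0$. A hermitian form is linear in the first argument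 and satisfies $(f,g)=\overline{(g,f)}$; it is not assumed nondegenerate or positive. *)

(* Defs.v *)
From HB Require Import structures.
From mathcomp Require Import all_boot all_order all_algebra.
From mathcomp Require Import finmap monalg.
From mathcomp Require Import complex.
From mathcomp Require Import classical_sets cardinality fsbigop reals.

Set Implicit Arguments.
Unset Strict Implicit.
Unset Printing Implicit Defensive.

Import Order.TTheory GRing.Theory Num.Theory.

Local Open Scope ring_scope.

Notation Z2 := (int * int)%type.

Definition linext (C : comNzRingType) (K : choiceType) (V : lmodType C)
    (F : K -> V) (x : {malg C[K]}) : V :=
  \sum_(k <- msupp x) x@_k *: F k.

Section LinextTheory.
Variables (C : comNzRingType) (K : choiceType) (V : lmodType C) (F : K -> V).

Lemma linextEw (d : {fset K}) (x : {malg C[K]}) :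
  (msupp x `<=` d)%fset -> linext F x = \sum_(k <- d) x@_k *: F k.
Proof.
move=> le_xd; rewrite /linext (big_fset_incl _ le_xd) //.
by move=> k _ /mcoeff_outdom ->; rewrite scale0r.
Qed.

Lemma linext_is_linear : linear (linext F).
Proof.
move=> c x y; set d := (msupp x `|` msupp y)%fset.
have lex : (msupp x `<=` d)%fset by apply: fsubsetUl.
have ley : (msupp y `<=` d)%fset by apply: fsubsetUr.
have lexy : (msupp (c *: x + y) `<=` d)%fset.
  apply: fsubset_trans (msuppD_le _ _) _.
  by rewrite fsetUSS // msuppZ_le.
rewrite (linextEw lex) (linextEw ley) (linextEw lexy) scaler_sumr -big_split.
by apply: eq_bigr => k _; rewrite mcoeffD mcoeffZ scalerDl scalerA.
Qed.

HB.instance Definition _ :=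
  GRing.isLinear.Build C {malg C[K]} V _ (linext F) linext_is_linear.

Lemma linext0 : linext F 0 = 0.
Proof. by rewrite /linext msupp0 big_seq_fset0. Qed.

Lemma linextU c k : linext F << c *g k >> = c *: F k.
Proof.
by rewrite (linextEw msuppU_le) big_seq_fset1 mcoeffUU.
Qed.

End LinextTheory.

Lemma malgZU (C : comNzRingType) (K : choiceType) (c d : C) (k : K) :
  c *: << d *g k >> = << c * d *g k >> :> {malg C[K]}.
Proof. by apply/malgP => l; rewrite mcoeffZ !mcoeffU mulrnAr. Qed.

(* << c *g (m, n) >> is c s^m t^n; the parameter q enters through qmul. *)
Notation qtorus C := {malg C[Z2]}.

Section Qtorus.
Variables (C : numClosedFieldType) (q : C).
Implicit Types (x y : qtorus C) (M N : Z2).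

Definition qmul x y : qtorus C :=
  linext (fun M => linext (fun N => << q ^ (M.2 * N.1) *g M + N >>) y) x.

Definition qbar x : qtorus C :=
  \sum_(M <- msupp x) (x@_M)^* *: << q ^ (M.1 * M.2) *g - M >>.

Definition qdegs : qtorus C -> qtorus C := linext (fun M => << M.1%:~R *g M >>).
Definition qdegt : qtorus C -> qtorus C := linext (fun M => << M.2%:~R *g M >>).

Lemma qmulUU c1 c2 M N :
  qmul << c1 *g M >> << c2 *g N >> = << c1 * c2 * q ^ (M.2 * N.1) *g M + N >>.
Proof.
by rewrite /qmul linextU linextU 2!malgZU mulrA.
Qed.

Lemma qdegs0 : qdegs 0 = 0.
Proof. exact: linext0. Qed.

Lemma qdegt0 : qdegt 0 = 0.
Proof. exact: linext0. Qed.

Lemma qmul0l x : qmul 0 x = 0.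
Proof. exact: linext0. Qed.

Lemma qmul0r x : qmul x 0 = 0.
Proof.
by rewrite /qmul [LHS]big1 // => M _; rewrite linext0 scaler0.
Qed.

Lemma qbarU c M : qbar << c *g M >> = << c^* * q ^ (M.1 * M.2) *g - M >>.
Proof.
rewrite /qbar msuppU; case: eqVneq => [->|c0].
  by rewrite big_seq_fset0 rmorph0 mul0r monalgU0.
by rewrite big_seq_fset1 mcoeffUU malgZU.
Qed.

Lemma qbarD : {morph qbar : x y / x + y}.
Proof.
move=> x y.
have E (d : {fset Z2}) z : (msupp z `<=` d)%fset ->
    qbar z = \sum_(M <- d) (z@_M)^* *: << q ^ (M.1 * M.2) *g - M >>.
  move=> le_zd; rewrite /qbar (big_fset_incl _ le_zd) //.
  by move=> k _ /mcoeff_outdom ->; rewrite rmorph0 scale0r.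
rewrite (E _ _ (msuppD_le x y)) (E _ _ (fsubsetUl (msupp x) (msupp y))).
rewrite (E _ _ (fsubsetUr (msupp x) (msupp y))) -big_split.
by apply: eq_bigr => M _; rewrite mcoeffD rmorphD scalerDl.
Qed.

Lemma qbarZ c x : qbar (c *: x) = c^* *: qbar x.
Proof.
have [->|c0] := eqVneq c 0.
  by rewrite scale0r rmorph0 scale0r /qbar msupp0 big_seq_fset0.
rewrite /qbar msuppZ (negbTE c0) scaler_sumr; apply: eq_bigr => M _.
by rewrite mcoeffZ rmorphM scalerA.
Qed.

End Qtorus.

(* ((A, (x, y)), (u, v)) is A + x c_s + y c_t + u d_s + v d_t. The entries of
   A are indexed by pairs because a matrix type over a mere lmodType is not
   an lmodType in the library. *)
Notation gl2q C :=
  ({ffun 'I_2 * 'I_2 -> qtorus C} * (C^o * C^o) * (C^o * C^o))%type.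

Section Gl2q.
Variables (C : numClosedFieldType) (q : C).
Implicit Types (a b : gl2q C) (i j k l : 'I_2) (M N : Z2) (x : qtorus C).

Definition glE i j x : gl2q C :=
  ([ffun p => if p == (i, j) then x else 0], 0, 0).
Definition gl_cs : gl2q C := (0, (1, 0), 0).
Definition gl_ct : gl2q C := (0, (0, 1), 0).
Definition gl_ds : gl2q C := (0, 0, (1, 0)).
Definition gl_dt : gl2q C := (0, 0, (0, 1)).

Definition entry a i j : qtorus C := a.1.1 (i, j).
Definition coef_cs a : C := a.1.2.1.
Definition coef_ct a : C := a.1.2.2.
Definition coef_ds a : C := a.2.1.
Definition coef_dt a : C := a.2.2.

Arguments glE : simpl never.
Arguments entry : simpl never.

(* The coefficients of c_s (w = fst) and c_t (w = snd) in [a, b]. *)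
Definition glcocycle (w : Z2 -> int) a b : C :=
  \sum_(i < 2) \sum_(j < 2) \sum_(M <- msupp (entry a i j))
    (entry a i j)@_M * (entry b j i)@_(- M) * q ^ (M.2 * - M.1) * (w M)%:~R.

Definition glbracket a b : gl2q C :=
  ([ffun p : 'I_2 * 'I_2 =>
      \sum_(k < 2) (qmul q (entry a p.1 k) (entry b k p.2)
                    - qmul q (entry b p.1 k) (entry a k p.2))
      + (coef_ds a *: qdegs (entry b p.1 p.2)
         - coef_ds b *: qdegs (entry a p.1 p.2))
      + (coef_dt a *: qdegt (entry b p.1 p.2)
         - coef_dt b *: qdegt (entry a p.1 p.2))],
   (glcocycle fst a b, glcocycle snd a b), 0).

Definition glomega a : gl2q C :=
  ([ffun p : 'I_2 * 'I_2 => (-1) ^+ (p.1 + p.2)%N *: qbar q (entry a p.2 p.1)],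
   ((coef_cs a)^*, (coef_ct a)^*),
   ((coef_ds a)^*, (coef_dt a)^*)).

Lemma entryD a b i j : entry (a + b) i j = entry a i j + entry b i j.
Proof. exact: ffunE. Qed.

Lemma entryZ c a i j : entry (c *: a) i j = c *: entry a i j.
Proof. exact: ffunE. Qed.

Lemma entryN a i j : entry (- a) i j = - entry a i j.
Proof. exact: ffunE. Qed.

Lemma entryE i j x k l :
  entry (glE i j x) k l = if (k == i) && (l == j) then x else 0.
Proof. by rewrite /entry ffunE xpair_eqE. Qed.

Lemma gl2qP a b :
  (forall i j, entry a i j = entry b i j) -> a.1.2 = b.1.2 -> a.2 = b.2 -> a = b.
Proof.
case: a b => [[A u] v] [[B u'] v'] /= eqAB -> ->; congr (_, _, _).
by apply/ffunP => -[i j]; exact: eqAB.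
Qed.

Lemma entry_omega a i j :
  entry (glomega a) i j = (-1) ^+ (i + j)%N *: qbar q (entry a j i).
Proof. exact: ffunE. Qed.

Lemma glomegaD : {morph glomega : a b / a + b}.
Proof.
move=> a b; apply: gl2qP => [i j||].
- by rewrite entryD !entry_omega entryD qbarD scalerDr.
- by congr (_, _); exact: (rmorphD Num.conj).
- by congr (_, _); exact: (rmorphD Num.conj).
Qed.

Lemma glomegaZ c a : glomega (c *: a) = c^* *: glomega a.
Proof.
apply: gl2qP => [i j||].
- by rewrite entryZ !entry_omega entryZ qbarZ !scalerA mulrC.
- exact: (congr2 pair (rmorphM _ c (coef_cs a)) (rmorphM _ c (coef_ct a))).
- exact: (congr2 pair (rmorphM _ c (coef_ds a)) (rmorphM _ c (coef_dt a))).
Qed.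

Lemma glomegaE i j x :
  glomega (glE i j x) = glE j i ((-1) ^+ (i + j)%N *: qbar q x).
Proof.
apply: gl2qP => [k l||]; last 2 first.
- by congr (_, _); exact: conjC0.
- by congr (_, _); exact: conjC0.
rewrite entry_omega !entryE andbC; case: ifP => [/andP[/eqP-> /eqP->]|_].
  by rewrite addnC.
by rewrite /qbar msupp0 big_seq_fset0 scaler0.
Qed.

Lemma glE_is_linear i j : linear (glE i j).
Proof.
move=> c x y; apply: gl2qP => [k l||].
- by rewrite entryD entryZ !entryE; case: ifP => // _; rewrite scaler0 addr0.
- by rewrite /= scaler0 addr0.
- by rewrite /= scaler0 addr0.
Qed.

Lemma qmul_entryE i j k l x y (r s : 'I_2) :
  \sum_(p < 2) qmul q (entry (glE i j x) r p) (entry (glE k l y) p s) =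
  entry (glE i l (if j == k then qmul q x y else 0)) r s.
Proof.
rewrite (bigD1 j) //= [X in _ + X]big1 ?addr0 => [|p /negbTE pj]; last first.
  by rewrite entryE pj andbF qmul0l.
rewrite !entryE eqxx andbT.
case: (r == i); case: (j == k); case: (s == l) => //=;
  by rewrite ?qmul0l ?qmul0r.
Qed.

Lemma glcocycleE w i j k l M N :
  glcocycle w (glE i j << M >>) (glE k l << N >>) =
  (q ^ (M.2 * N.1) *+ [&& j == k, i == l & M + N == 0]) * (w M)%:~R.
Proof.
rewrite /glcocycle.
move: (entryE i j << M >>) (entryE k l << N >>).
move: (glE i j _) (glE k l _) => a b Ea Eb.
rewrite (bigD1 i) //= [X in _ + X]big1 ?addr0; last first.
  move=> r /negbTE ri; rewrite big1 // => s _.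
  by rewrite Ea ri msupp0 big_seq_fset0.
rewrite (bigD1 j) //= [X in _ + X]big1 ?addr0; last first.
  by move=> s /negbTE sj; rewrite Ea sj andbF msupp0 big_seq_fset0.
rewrite Ea !eqxx msuppU oner_eq0 big_seq_fset1 mcoeffUU mul1r Eb.
rewrite (eq_sym j) (eq_sym i) (addrC M N) addr_eq0.
case: (k == j); case: (l == i); rewrite /= ?mcoeff0 ?mul0r // mcoeffU.
by case: eqP => [->|_]; rewrite ?mul1r // !mul0r.
Qed.

Lemma glbracketEE i j k l M N :
  glbracket (glE i j << M >>) (glE k l << N >>) =
    (q ^ (M.2 * N.1) *+ (j == k)) *: glE i l << M + N >>
    - (q ^ (N.2 * M.1) *+ (i == l)) *: glE k j << M + N >>
    + (q ^ (M.2 * N.1) *+ [&& j == k, i == l & M + N == 0])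
        *: (M.1%:~R *: gl_cs + M.2%:~R *: gl_ct).
Proof.
apply: gl2qP => [r s||].
- have -> : entry (glbracket (glE i j << M >>) (glE k l << N >>)) r s =
    \sum_(p < 2) (qmul q (entry (glE i j << M >>) r p) (entry (glE k l << N >>) p s)
      - qmul q (entry (glE k l << N >>) r p) (entry (glE i j << M >>) p s)).
    rewrite [LHS]ffunE /=.
    have Z (S x y z t : qtorus C) :
        S + (0 *: x - 0 *: y) + (0 *: z - 0 *: t) = S.
      by rewrite !scale0r !subr0 !addr0.
    exact: Z.
  have e0 (d : C^o * C^o) : entry ((0, d, 0) : gl2q C) r s = 0 by exact: ffunE.
  rewrite sumrB.
  transitivity (entry (glE i l (if j == k then qmul q << M >> << N >> else 0)) r s
     - entry (glE k j (if l == i then qmul q << N >> << M >> else 0)) r s).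
    by congr (_ - _); exact: qmul_entryE.
  rewrite (qmulUU q 1 1 M N).
  rewrite (qmulUU q 1 1 N M).
  have -> : N + M = M + N by exact: addrC.
  rewrite mul1r mul1r !(eq_sym l).
  rewrite entryD entryD.
  have gen (x y u v w : qtorus C) : x = u -> - y = v -> w = 0 -> x - y = u + v + w.
    by move=> -> -> ->; rewrite addr0.
  apply: gen.
  + rewrite entryZ !entryE; case: ifP => _; last by rewrite scaler0.
    case: (j == k); last by rewrite scale0r.
    by rewrite malgZU ?mul1r mulr1.
  + rewrite -entryN; congr (entry _ r s); congr (- _).
    apply: gl2qP => [r' s'||]; last 2 first.
    * by rewrite /= scaler0.
    * by rewrite /= scaler0.
    rewrite entryZ !entryE; case: ifP => _; last by rewrite scaler0.
    case: (i == l); last by rewrite scale0r.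
    by rewrite malgZU ?mul1r mulr1.
  + have e1 : entry gl_cs r s = 0 by exact: e0.
    have e2 : entry gl_ct r s = 0 by exact: e0.
    by rewrite entryZ entryD entryZ e1 entryZ e2 !scaler0 addr0 scaler0.
- have gen (x y z m n : C) :
      (z * m, z * n) = x *: (0 : C^o * C^o) - y *: 0 + z *: (m *: (1, 0) + n *: (0, 1)).
    rewrite !scaler0 subrr add0r; congr (_, _).
      by rewrite -[RHS]/(z * (m * 1 + n * 0)) mulr1 mulr0 addr0.
    by rewrite -[RHS]/(z * (m * 0 + n * 1)) mulr1 mulr0 add0r.
  rewrite -[RHS]gen.
  exact: (congr2 pair (glcocycleE fst i j k l M N) (glcocycleE snd i j k l M N)).
- by rewrite /= !(scaler0, addr0, oppr0).
Qed.

Lemma glbracket_cd (u v : C^o * C^o) b :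
  glbracket (0, u, v) b =
    ([ffun p => v.1 *: qdegs (entry b p.1 p.2) + v.2 *: qdegt (entry b p.1 p.2)],
     0, 0).
Proof.
have e0 i j : entry ((0, u, v) : gl2q C) i j = 0 by exact: ffunE.
have sum0 w : glcocycle w (0, u, v) b = 0.
  rewrite /glcocycle big1 // => i _; rewrite big1 // => j _.
  by rewrite e0 msupp0 big_seq_fset0.
congr (_, _, _); last by congr (_, _); exact: sum0.
apply/ffunP => -[i j]; rewrite !ffunE /= big1 => [|k _]; last first.
  by rewrite !e0 qmul0l qmul0r subrr.
have gen (W : lmodType C) (c d c' d' : C) (x y o o' : W) : o = 0 -> o' = 0 ->
    0 + (c *: x - c' *: o) + (d *: y - d' *: o') = c *: x + d *: y.
  by move=> -> ->; rewrite !scaler0 !subr0 add0r.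
by rewrite (e0 i j); apply: gen; [exact: qdegs0 | exact: qdegt0].
Qed.

Lemma glbracket_cs b : glbracket gl_cs b = 0.
Proof.
rewrite /gl_cs glbracket_cd; congr (_, _, _).
apply/ffunP => p; rewrite ffunE [RHS]ffunE.
have gen (W : lmodType C) (x y : W) : (0 : C) *: x + (0 : C) *: y = 0.
  by rewrite !scale0r addr0.
exact: gen.
Qed.

Lemma glbracket_ct b : glbracket gl_ct b = 0.
Proof.
rewrite /gl_ct glbracket_cd; congr (_, _, _).
apply/ffunP => p; rewrite ffunE [RHS]ffunE.
have gen (W : lmodType C) (x y : W) : (0 : C) *: x + (0 : C) *: y = 0.
  by rewrite !scale0r addr0.
exact: gen.
Qed.

Lemma glbracket_ds_dt : glbracket gl_ds gl_dt = 0.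
Proof.
rewrite /gl_ds glbracket_cd; congr (_, _, _).
apply/ffunP => -[i j]; rewrite !ffunE /=.
have -> : entry gl_dt i j = 0 by exact: ffunE.
by rewrite qdegs0 qdegt0 !scaler0 addr0.
Qed.

Lemma glbracket_dsE i j M :
  glbracket gl_ds (glE i j << M >>) = M.1%:~R *: glE i j << M >>.
Proof.
rewrite /gl_ds glbracket_cd; apply: gl2qP => [k l||]; last 2 first.
- by rewrite /= scaler0.
- by rewrite /= scaler0.
rewrite entryZ entryE [LHS]ffunE /= entryE scale1r scale0r addr0.
case: ifP => _; last by rewrite qdegs0 scaler0.
by rewrite /qdegs linextU !malgZU mul1r mulr1.
Qed.

Lemma glbracket_dtE i j M :
  glbracket gl_dt (glE i j << M >>) = M.2%:~R *: glE i j << M >>.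
Proof.
rewrite /gl_dt glbracket_cd; apply: gl2qP => [k l||]; last 2 first.
- by rewrite /= scaler0.
- by rewrite /= scaler0.
rewrite entryZ entryE [LHS]ffunE /= entryE scale1r scale0r add0r.
case: ifP => _; last by rewrite qdegt0 scaler0.
by rewrite /qdegt linextU !malgZU mul1r mulr1.
Qed.

End Gl2q.

(* The polynomial ring C[x_A : A in Z^2]; << ucm A >> is the variable x_A. *)
Notation Fock C := {malg C[{cmonom Z2}]}.

Section Operators.
Variables (C : numClosedFieldType) (q : C) (X : Z2 -> 'M[C]_2) (mu : C).
Implicit Types (A M N : Z2) (f g : Fock C).

(* divcm truncates exponents at 0, but then the coefficient m A vanishes. *)
Definition pderiv A : Fock C -> Fock C :=
  linext (fun m => << (m A)%:R *g divcm m (ucm A) >>).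

(* X A 0 0, X A 1 0 and X A 1 1 are a_A, c_A and d_A. The entry X A 0 1 does
   not occur: X A is meant to be lower triangular. *)
Definition opP A f : Fock C := X A 0 0 *: pderiv A f.

Definition opQ A f : Fock C :=
  X A 1 0 *: pderiv A f + X A 1 1 *: (<< ucm A >> * f).

(* These sums have finite support on every polynomial, by
   fsum_QP and fsum_QPP below. *)
Definition e12 M f : Fock C :=
  - ((q ^ (- (M.1 * M.2)) * mu) *: opP (- M) f)
  - \sum_(p \in [set: Z2 * Z2])
      q ^ (M.2 * p.2.1 + p.1.2 * M.1 + p.1.2 * p.2.1)
        *: opQ (p.1 + p.2 + M) (opP p.1 (opP p.2 f)).

Definition e21 M f : Fock C := opQ M f.

Definition e11 M f : Fock C :=
  - (\sum_(N \in [set: Z2]) q ^ (N.2 * M.1) *: opQ (N + M) (opP N f))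
  - (mu / 2%:R *+ (M == 0)) *: f.

Definition e22 M f : Fock C :=
  (\sum_(N \in [set: Z2]) q ^ (N.1 * M.2) *: opQ (N + M) (opP N f))
  + (mu / 2%:R *+ (M == 0)) *: f.

Definition opD1 f : Fock C :=
  \sum_(N \in [set: Z2]) N.1%:~R *: opQ N (opP N f).

Definition opD2 f : Fock C :=
  \sum_(N \in [set: Z2]) N.2%:~R *: opQ N (opP N f).

Definition eop (i j : 'I_2) : Z2 -> Fock C -> Fock C :=
  if i == 0 then (if j == 0 then e11 else e12)
  else (if j == 0 then e21 else e22).

(* c_s and c_t act by 0. *)
Definition gl_repr (a : gl2q C) f : Fock C :=
  \sum_(i < 2) \sum_(j < 2) linext (fun M => eop i j M f) (entry a i j)
  + coef_ds a *: opD1 f + coef_dt a *: opD2 f.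

Definition contravariant (form : Fock C -> Fock C -> C) : Prop :=
  form 1 1 = 1 /\
  forall (a : gl2q C) f g,
    form (gl_repr a f) g = form f (gl_repr (glomega q a) g).

Definition vars f : {fset Z2} := (\bigcup_(m <- msupp f) finsupp m)%fset.

Lemma pderiv_eq0 A f : A \notin vars f -> pderiv A f = 0.
Proof.
move=> Af; rewrite /pderiv /linext big_seq big1 // => m mf.
suff -> : m A = 0%N by rewrite monalgU0 scaler0.
apply/eqP; rewrite cmE_eq0; apply: contra Af => Am.
by apply/bigfcupP; exists m; rewrite ?mf.
Qed.

Lemma opP_eq0 A f : A \notin vars f -> opP A f = 0.
Proof. by move=> Af; rewrite /opP pderiv_eq0 // scaler0. Qed.

Lemma opQ0 A : opQ A 0 = 0.
Proof. by rewrite /opQ /pderiv linext0 mulr0 !scaler0 addr0. Qed.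

(* The sums over all of Z^2 reduce to sums over explicit finite sets. *)
Lemma fsum_QP f (c : Z2 -> C) (s : Z2 -> Z2) :
  \sum_(N \in [set: Z2]) c N *: opQ (s N) (opP N f) =
  \sum_(N <- vars f) c N *: opQ (s N) (opP N f).
Proof. by apply: fsbigTE => N /opP_eq0 ->; rewrite opQ0 scaler0. Qed.

Lemma fsum_QPP f (c : Z2 * Z2 -> C) (s : Z2 * Z2 -> Z2) :
  \sum_(p \in [set: Z2 * Z2]) c p *: opQ (s p) (opP p.1 (opP p.2 f)) =
  \sum_(p <- [fset ((M, N) : Z2 * Z2) | N in vars f, M in vars (opP N f)]%fset)
    c p *: opQ (s p) (opP p.1 (opP p.2 f)).
Proof.
apply: fsbigTE => -[M N] /= MN.
suff -> : opP M (opP N f) = 0 by rewrite opQ0 scaler0.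
have [Nf|/opP_eq0 ->] := boolP (N \in vars f); last first.
  by rewrite /opP /pderiv linext0 scaler0.
apply: opP_eq0; apply: contra MN => Mf.
by apply/imfset2P; exists N => //; exists M.
Qed.

Lemma gl_repr_is_linear f : linear (gl_repr^~ f).
Proof.
have gen (W : lmodType C) (A B D : 'I_2 -> 'I_2 -> W) (c u u' v v' : C) (x y : W) :
    (forall i j, D i j = c *: A i j + B i j) ->
    \sum_(i < 2) \sum_(j < 2) D i j + (c * u + u') *: x + (c * v + v') *: y =
    c *: (\sum_(i < 2) \sum_(j < 2) A i j + u *: x + v *: y)
    + (\sum_(i < 2) \sum_(j < 2) B i j + u' *: x + v' *: y).
  move=> ED; rewrite !scalerDr !scalerDl !scalerA [RHS]addrACA [X in _ = X + _]addrACA.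
  congr (_ + _ + _); rewrite scaler_sumr -big_split; apply: eq_bigr => i _ /=.
  by rewrite scaler_sumr -big_split; apply: eq_bigr => j _ /=.
move=> c a b; apply: gen => i j.
by rewrite entryD entryZ linext_is_linear.
Qed.

Lemma gl_reprE i j c M f : gl_repr (glE i j << c *g M >>) f = c *: eop i j M f.
Proof.
have gen (W : lmodType C) (S x y : W) : S + (0 : C) *: x + (0 : C) *: y = S.
  by rewrite !scale0r !addr0.
rewrite /gl_repr; etransitivity; first exact: gen.
move: (entryE i j << c *g M >>); move: (glE i j _) => a Ea.
rewrite (bigD1 i) //= [X in _ + X]big1 ?addr0; last first.
  by move=> r /negbTE ri; rewrite big1 // => s _; rewrite Ea ri linext0.
rewrite (bigD1 j) //= [X in _ + X]big1 ?addr0; last first.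
  by move=> s /negbTE sj; rewrite Ea sj andbF linext0.
by rewrite Ea !eqxx linextU.
Qed.

Lemma gl_repr_cd (u v : C^o * C^o) f :
  gl_repr (0, u, v) f = v.1 *: opD1 f + v.2 *: opD2 f.
Proof.
have gen (W : lmodType C) (S x y : W) (c d : C) : S = 0 ->
    S + c *: x + d *: y = c *: x + d *: y.
  by move=> ->; rewrite add0r.
apply: gen; rewrite big1 // => i _; rewrite big1 // => j _.
have -> : entry ((0, u, v) : gl2q C) i j = 0 by exact: ffunE.
exact: linext0.
Qed.

Lemma gl_repr_cs f : gl_repr (gl_cs C) f = 0.
Proof.
have gen (W : lmodType C) (x y : W) : (0 : C) *: x + (0 : C) *: y = 0.
  by rewrite !scale0r addr0.
by rewrite [LHS]gl_repr_cd; exact: gen.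
Qed.

Lemma gl_repr_ct f : gl_repr (gl_ct C) f = 0.
Proof.
have gen (W : lmodType C) (x y : W) : (0 : C) *: x + (0 : C) *: y = 0.
  by rewrite !scale0r addr0.
by rewrite [LHS]gl_repr_cd; exact: gen.
Qed.

Lemma gl_repr_ds f : gl_repr (gl_ds C) f = opD1 f.
Proof.
have gen (W : lmodType C) (x y : W) : (1 : C) *: x + (0 : C) *: y = x.
  by rewrite scale1r scale0r addr0.
by rewrite [LHS]gl_repr_cd; exact: gen.
Qed.

Lemma gl_repr_dt f : gl_repr (gl_dt C) f = opD2 f.
Proof.
have gen (W : lmodType C) (x y : W) : (0 : C) *: x + (1 : C) *: y = y.
  by rewrite scale1r scale0r add0r.
by rewrite [LHS]gl_repr_cd; exact: gen.
Qed.

End Operators.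

(* Main.v *)
(* Let B_A = - q^(A_1 A_2) e_12(-A), the operator that the anti-involution
   forces to be the adjoint of e_21(A) = Q_A. The Q_A commute, their products
   applied to 1 form a basis of V (each a_A d_A = 1), and 1 is killed by every
   P_A; so a form with adjoints B_A of the Q_A and (1, g) the conjugate of the
   constant term of g in this basis exists and is unique as soon as the B_A
   commute. An identity between linear operators can be checked on 1 and by
   commuting both sides past the Q_A. This gives the brackets of the e_ij, in
   particular [B_A, B_B] = 0, from the brackets [e_ij, Q_A]; then the adjoints
   of e_11, e_22, e_12, D_1, D_2; and finally the hermitian symmetry. *)
Require Import Defs.
From HB Require Import structures.
From mathcomp Require Import all_boot all_order all_algebra.
From mathcomp Require Import finmap monalg complex reals.
From mathcomp Require Import classical_sets cardinality fsbigop.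
From mathcomp Require Import ring.

Set Implicit Arguments.
Unset Strict Implicit.
Unset Printing Implicit Defensive.

Import Order.TTheory GRing.Theory Num.Theory.
Local Open Scope ring_scope.

(** * The polynomial ring as a module over the Weyl algebra *)

Lemma malg_ind (C : comNzRingType) (K : choiceType) (S : {malg C[K]} -> Prop) :
  (forall c f g, S f -> S g -> S (c *: f + g)) -> S 0 ->
  (forall k, S << k >>) -> forall f, S f.
Proof.
move=> SP S0 SU f; rewrite [f]monalgE.
elim: (msupp f : seq K) => [|k s IH]; first by rewrite big_nil.
by rewrite big_cons -[f@_k]mulr1 -malgZU; apply: SP.
Qed.

(* Locked, since a conversion test between unequal polynomials otherwise
   unfolds them down to their finite maps. *)
HB.lock Definition partial (C : numClosedFieldType) (A : Z2) : Fock C -> Fock C :=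
  @pderiv C A.
HB.lock Definition xmul (C : numClosedFieldType) (A : Z2) (f : Fock C) : Fock C :=
  << ucm A >> * f.
HB.lock Definition mulx (A : Z2) (m : {cmonom Z2}) : {cmonom Z2} := mmul (ucm A) m.
HB.lock Definition mon (C : numClosedFieldType) (m : {cmonom Z2}) : Fock C := << m >>.
Arguments partial {C} A f.
Arguments xmul {C} A f.
Arguments mon {C} m.

Section WeylAlgebra.
Variable C : numClosedFieldType.
Implicit Types (A B : Z2) (m : {cmonom Z2}) (f g : Fock C).

Lemma partial_is_linear A : linear (@partial C A).
Proof. by rewrite unlock; exact: linext_is_linear. Qed.

HB.instance Definition _ A :=
  GRing.isLinear.Build C (Fock C) (Fock C) _ (@partial C A) (partial_is_linear A).

Lemma xmul_is_linear A : linear (@xmul C A).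
Proof. by move=> c f g; rewrite unlock mulrDr -(scalerAr c). Qed.

HB.instance Definition _ A :=
  GRing.isLinear.Build C (Fock C) (Fock C) _ (@xmul C A) (xmul_is_linear A).

Lemma mon1 : mon mone = 1 :> Fock C.
Proof. by rewrite unlock. Qed.

Lemma xmul_mon A m : xmul A (mon m) = mon (mulx A m) :> Fock C.
Proof. by rewrite !unlock malgM_def fgmulUU mulr1. Qed.

Lemma partial_mon A m :
  partial A (mon m) = (m A)%:R *: mon (divcm m (ucm A)) :> Fock C.
Proof. by rewrite !unlock /pderiv linextU scale1r malgZU mulr1. Qed.

Lemma mulxE A m B : mulx A m B = ((A == B) + m B)%N.
Proof. by rewrite unlock cmM cmU. Qed.

Lemma mdeg_mulx A m : mdeg (mulx A m) = (mdeg m).+1.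
Proof. by rewrite unlock mdegM mdegU add1n. Qed.

Lemma mulx_divcm A m : m A != 0%N -> mulx A (divcm m (ucm A)) = m.
Proof.
move=> mA; apply/eqP/cmP => i; rewrite mulxE divcmE.
rewrite ucmE; case: eqVneq => [<-|]; first by rewrite subnKC // lt0n.
by rewrite add0n subn0.
Qed.

Lemma eq_linear_mon (V : lmodType C) (F G : {linear Fock C -> V}) :
  (forall m, F (mon m) = G (mon m)) -> F =1 G.
Proof.
move=> FG; apply: malg_ind => [c f g Ff Fg||m]; last 2 first.
- by rewrite !linear0.
- by have := FG m; rewrite mon.unlock.
- by rewrite !linearP Ff Fg.
Qed.

Lemma fock_ind (S : Fock C -> Prop) :
  (forall c f g, S f -> S g -> S (c *: f + g)) -> S 1 ->
  (forall A f, S f -> S (xmul A f)) -> forall f, S f.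
Proof.
move=> SP S1 SX.
have S0 : S 0 by have := SP (-1) _ _ S1 S1; rewrite scaleN1r addNr.
apply: (malg_ind SP S0) => m; have -> : << m >> = mon m by rewrite unlock.
move: {2}(mdeg m) (erefl (mdeg m)) => n; elim: n m => [|n IH] m mn.
  by rewrite (mdeg_eq0I mn) mon1.
have [A mA] : exists A, m A != 0%N.
  have [] := boolP (finsupp m == fset0); last first.
    by case/fset0Pn => A; rewrite -cmE_neq0; exists A.
  by move/eqP => m0; move: mn; rewrite mdegE m0 big_seq_fset0.
rewrite -(mulx_divcm mA) -xmul_mon; apply: SX; apply: IH.
by move: mn; rewrite -{1}(mulx_divcm mA) mdeg_mulx => -[].
Qed.

Lemma eq_linear_poly (V : lmodType C) (F G : {linear Fock C -> V}) :
  F 1 = G 1 -> (forall A f, F f = G f -> F (xmul A f) = G (xmul A f)) -> F =1 G.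
Proof.
move=> FG1 FGX; apply: fock_ind => // c f g Ff Fg.
by rewrite !linearP Ff Fg.
Qed.

Lemma partial1 A : partial A 1 = 0 :> Fock C.
Proof. by rewrite -mon1 partial_mon cm1 scale0r. Qed.

Lemma xmulC A B f : xmul A (xmul B f) = xmul B (xmul A f).
Proof. rewrite unlock; exact: mulrCA. Qed.

Lemma partial_xmul A B f :
  partial A (xmul B f) = xmul B (partial A f) + (A == B)%:R *: f.
Proof.
apply: (@eq_linear_mon _ (@partial C A \o @xmul C B)
  ((@xmul C B \o @partial C A) \+ (A == B)%:R \*: idfun)) => {f} m /=.
rewrite xmul_mon !partial_mon linearZ /= xmul_mon.
rewrite mulxE eq_sym; have [->|neAB] := eqVneq A B; last first.
  rewrite add0n scale0r addr0; have [->|mA] := eqVneq (m A) 0%N.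
    by rewrite !scale0r.
  congr (_ *: mon _).
  apply/eqP/cmP => i; rewrite divcmE !mulxE divcmE ucmE.
  case: (eqVneq A i) => [<-|]; last by rewrite !subn0.
  by rewrite eq_sym (negbTE neAB).
have -> : divcm (mulx B m) (ucm B) = m.
  by apply/eqP/cmP => i; rewrite divcmE mulxE ucmE addKn.
(* If x_B does not occur in [m], the truncated quotient times x_B is not [m], but the coefficient in
   front of it is 0. *)
have [->|mA] := eqVneq (m B) 0%N; first by rewrite scale0r add0r.
by rewrite mulx_divcm // addnC natrD scalerDl.
Qed.

Lemma partialC A B f : partial A (partial B f) = partial B (partial A f).
Proof.
apply: (@eq_linear_poly _ (@partial C A \o @partial C B)
  (@partial C B \o @partial C A)) => {f} /= [|D f IH].
  by rewrite !partial1 !linear0.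
rewrite (partial_xmul A) (partial_xmul B) 2!linearD !linearZ /= !partial_xmul IH.
exact: addrAC.
Qed.

End WeylAlgebra.

(** * Locally finite sums of oscillators *)

Section OscillatorSums.
Variables (C : fieldType) (V : lmodType C) (I : zmodType).
Variables P Q : I -> {linear V -> V}.
Hypothesis QC : forall A B v, Q A (Q B v) = Q B (Q A v).
Hypothesis PC : forall A B v, P A (P B v) = P B (P A v).
Hypothesis PQ : forall A B v, P A (Q B v) = Q B (P A v) + (A == B)%:R *: v.
Hypothesis Pfin : forall v, exists d : {fset I}, forall A, A \notin d -> P A v = 0.
Implicit Types (A B M N : I) (u v : V) (d : {fset I}).

(** This sum and the quadratic one below are normally ordered: annihilators act first, so only
    finitely many terms survive on a given vector. *)
Definition osc1 (c : I -> C) (s : I -> I) v : V :=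
  \sum_(N \in [set: I]) c N *: Q (s N) (P N v).

Definition osc2 (c : I * I -> C) (s : I * I -> I) v : V :=
  \sum_(p \in [set: I * I]) c p *: Q (s p) (P p.1 (P p.2 v)).

(** The finite set [d] is left free, so that all vectors occurring in one identity can share it. *)
Lemma osc1E d c s v : (forall A, A \notin d -> P A v = 0) ->
  osc1 c s v = \sum_(N <- d) c N *: Q (s N) (P N v).
Proof. by move=> Pd; apply: fsbigTE => N /Pd ->; rewrite linear0 scaler0. Qed.

Lemma osc2E d c s v : (forall A, A \notin d -> P A v = 0) ->
  osc2 c s v = \sum_(M <- d) \sum_(N <- d) c (M, N) *: Q (s (M, N)) (P M (P N v)).
Proof.
move=> Pd; rewrite /osc2 (@fsbigTE _ _ _ _ (d `*` d)%fset) => [|[M N]].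
  by rewrite big_imfset2 //=; move=> [??] [??] _ _ /= [-> ->].
rewrite in_fsetM /= negb_and => /orP[] /Pd E; first by rewrite PC E !linear0.
by rewrite E !linear0.
Qed.

Lemma osc1_linear c s : linear (osc1 c s).
Proof.
move=> k u v; have [d1 Pd1] := Pfin u; have [d2 Pd2] := Pfin v.
have P1 A : A \notin (d1 `|` d2)%fset -> P A u = 0.
  by rewrite in_fsetU negb_or => /andP[/Pd1].
have P2 A : A \notin (d1 `|` d2)%fset -> P A v = 0.
  by rewrite in_fsetU negb_or => /andP[_ /Pd2].
rewrite (osc1E _ _ P1) (osc1E _ _ P2) (@osc1E (d1 `|` d2)%fset); last first.
  by move=> A Ad; rewrite linearP P1 // P2 // scaler0 addr0.
rewrite scaler_sumr -big_split; apply: eq_bigr => N _ /=.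
by rewrite !linearP.
Qed.

Lemma osc2_linear c s : linear (osc2 c s).
Proof.
move=> k u v; have [d1 Pd1] := Pfin u; have [d2 Pd2] := Pfin v.
have P1 A : A \notin (d1 `|` d2)%fset -> P A u = 0.
  by rewrite in_fsetU negb_or => /andP[/Pd1].
have P2 A : A \notin (d1 `|` d2)%fset -> P A v = 0.
  by rewrite in_fsetU negb_or => /andP[_ /Pd2].
rewrite (osc2E _ _ P1) (osc2E _ _ P2) (@osc2E (d1 `|` d2)%fset); last first.
  by move=> A Ad; rewrite linearP P1 // P2 // scaler0 addr0.
rewrite scaler_sumr -big_split; apply: eq_bigr => M _ /=.
rewrite scaler_sumr -big_split; apply: eq_bigr => N _ /=.
by rewrite !linearP.
Qed.

(** [Q A] commutes with every [P B] except [P A], so a finite set that works for [v] only has to be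
    enlarged by [A]. *)
Lemma PQ_fin A v : exists2 d : {fset I}, A \in d &
  (forall B, B \notin d -> P B v = 0) /\ (forall B, B \notin d -> P B (Q A v) = 0).
Proof.
have [d Pd] := Pfin v; exists (A |` d)%fset; first by rewrite fset1U1.
split=> B; rewrite in_fset1U negb_or => /andP[/negbTE nBA /Pd] //.
by rewrite PQ nBA scale0r addr0 => ->; rewrite linear0.
Qed.

Lemma sum_delta d A (F : I -> V) : A \in d ->
  \sum_(N <- d) (N == A)%:R *: F N = F A.
Proof.
move=> Ad; rewrite (bigD1_seq A) ?fset_uniq //= eqxx scale1r big1 ?addr0 //.
by move=> N /negbTE ->; rewrite scale0r.
Qed.

(** Only the summand with N = A fails to commute with [Q A]. *)
Lemma osc1_Q c s A v : osc1 c s (Q A v) = Q A (osc1 c s v) + c A *: Q (s A) v.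
Proof.
have [d Ad [Pv PQv]] := PQ_fin A v.
rewrite (osc1E _ _ Pv) (osc1E _ _ PQv) linear_sum.
rewrite -(sum_delta (fun N => c N *: Q (s N) v) Ad).
rewrite -big_split; apply: eq_bigr => N _ /=.
rewrite PQ linearD scalerDr QC (linearZ_LR (Q A)); congr (_ + _).
by rewrite (linearZ_LR (Q (s N))) !scalerA mulrC.
Qed.

(** Either of the two annihilators can be contracted with [Q A]; the other one survives, which gives
    two sums with a single annihilator. *)
Lemma osc2_Q c s A v : osc2 c s (Q A v) = Q A (osc2 c s v)
  + osc1 (fun N => c (A, N)) (fun N => s (A, N)) v
  + osc1 (fun N => c (N, A)) (fun N => s (N, A)) v.
Proof.
have [d Ad [Pv PQv]] := PQ_fin A v.
rewrite (osc2E _ _ Pv) (osc2E _ _ PQv) (osc1E _ _ Pv) (osc1E _ _ Pv) linear_sum.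
rewrite -[X in _ + X + _](sum_delta (fun M =>
  \sum_(N <- d) c (M, N) *: Q (s (M, N)) (P N v)) Ad) -!big_split.
apply: eq_bigr => M _ /=; rewrite scaler_sumr linear_sum.
rewrite -(sum_delta (fun N => c (M, N) *: Q (s (M, N)) (P M v)) Ad) -!big_split.
apply: eq_bigr => N _ /=.
rewrite PQ (linearD (P M)) PQ 2!(linearD (Q (s (M, N)))) 2!scalerDr QC.
rewrite (linearZ_LR (Q A)) (linearZ_LR (P M)) !(linearZ_LR (Q (s (M, N)))).
by rewrite !scalerA !(mulrC (c _)).
Qed.

Lemma osc1_vac c s v : (forall A, P A v = 0) -> osc1 c s v = 0.
Proof. by move=> Pv; rewrite (@osc1E fset0) ?big_seq_fset0. Qed.

Lemma osc2_vac c s v : (forall A, P A v = 0) -> osc2 c s v = 0.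
Proof. by move=> Pv; rewrite (@osc2E fset0) ?big_seq_fset0. Qed.

Lemma osc1Z k c s v : osc1 (fun N => k * c N) s v = k *: osc1 c s v.
Proof.
have [d Pd] := Pfin v; rewrite !(osc1E _ _ Pd) scaler_sumr.
by apply: eq_bigr => N _; rewrite scalerA.
Qed.

Lemma eq_osc1 c c' s s' v : c =1 c' -> s =1 s' -> osc1 c s v = osc1 c' s' v.
Proof. by move=> Ec Es; apply: eq_fsbigr => N _; rewrite Ec Es. Qed.

End OscillatorSums.

(** * Realization of the e_ij by abstract oscillators *)

Section OscillatorRealization.
Variables (C : numFieldType) (V : lmodType C) (P Q : Z2 -> {linear V -> V}).
Hypothesis QC : forall A B v, Q A (Q B v) = Q B (Q A v).
Hypothesis PC : forall A B v, P A (P B v) = P B (P A v).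
Hypothesis PQ : forall A B v, P A (Q B v) = Q B (P A v) + (A == B)%:R *: v.
Hypothesis Pfin : forall v, exists d : {fset Z2}, forall A, A \notin d -> P A v = 0.
Variables (q mu : C).
Hypothesis q0 : q != 0.
Implicit Types (A B M N : Z2) (v : V).

(** For the concrete P_A and Q_A these are the given operators up to conversion; their commutators
    with Q_A follow from the oscillator relations and local finiteness alone. *)
Definition osc_e11 M v : V :=
  - osc1 P Q (fun N => q ^ (N.2 * M.1)) (fun N => N + M) v
  - (mu / 2%:R *+ (M == 0)) *: v.

Definition osc_e22 M v : V :=
  osc1 P Q (fun N => q ^ (N.1 * M.2)) (fun N => N + M) v
  + (mu / 2%:R *+ (M == 0)) *: v.

Definition osc_e12 M v : V :=
  - ((q ^ (- (M.1 * M.2)) * mu) *: P (- M) v)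
  - osc2 P Q
      (fun p => q ^ (M.2 * p.2.1 + p.1.2 * M.1 + p.1.2 * p.2.1))
      (fun p => p.1 + p.2 + M) v.

Definition osc_deg (w : Z2 -> C) v : V := osc1 P Q w id v.

Lemma osc_e11_is_linear M : linear (osc_e11 M).
Proof.
move=> c u v; rewrite /osc_e11 osc1_linear // opprD scalerBr scalerN.
by rewrite scalerDr opprD !scalerA mulrC addrACA.
Qed.

Lemma osc_e22_is_linear M : linear (osc_e22 M).
Proof.
move=> c u v; rewrite /osc_e22 osc1_linear // scalerDr.
by rewrite scalerDr !scalerA mulrC addrACA.
Qed.

Lemma osc_e12_is_linear M : linear (osc_e12 M).
Proof.
move=> c u v; rewrite /osc_e12 osc2_linear // linearP scalerDr.
by rewrite opprD !scalerA (mulrC _ c) -!scalerA scalerBr scalerN opprD addrACA.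
Qed.

Lemma osc_e11_Q M A v :
  osc_e11 M (Q A v) = Q A (osc_e11 M v) - q ^ (A.2 * M.1) *: Q (A + M) v.
Proof.
rewrite /osc_e11 osc1_Q // linearB linearN (linearZ_LR (Q A)) opprD -!addrA.
by congr (_ + _); rewrite addrC.
Qed.

Lemma osc_e22_Q M A v :
  osc_e22 M (Q A v) = Q A (osc_e22 M v) + q ^ (A.1 * M.2) *: Q (A + M) v.
Proof.
rewrite /osc_e22 osc1_Q // linearD (linearZ_LR (Q A)) -!addrA.
by congr (_ + _); rewrite addrC.
Qed.

Lemma osc_deg_Q w A v :
  osc_deg w (Q A v) = Q A (osc_deg w v) + w A *: Q A v.
Proof. exact: osc1_Q. Qed.

Lemma osc_e12_Q M A v :
  osc_e12 M (Q A v) = Q A (osc_e12 M v)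
  + q ^ (M.2 * A.1) *: osc_e11 (A + M) v - q ^ (A.2 * M.1) *: osc_e22 (A + M) v.
Proof.
rewrite /osc_e12 osc2_Q // PQ /=.
set S1 := osc1 _ _ _ _ v; set S2 := osc1 _ _ _ _ v.
(* Contracting the first index with A leaves the exponent A_2 M_1 + N_1 (A + M)_2, hence the sum in
   e_22 at A + M. Contracting the second index gives e_11 in the same way. *)
have -> : S1 = q ^ (A.2 * M.1) *:
    osc1 P Q (fun N => q ^ (N.1 * (A + M).2)) (fun N => N + (A + M)) v.
  rewrite -osc1Z //; apply: eq_osc1 => N /=; last by rewrite addrCA addrA.
  by rewrite -expfzDr //; congr (q ^ _); ring.
have -> : S2 = q ^ (M.2 * A.1) *:
    osc1 P Q (fun N => q ^ (N.2 * (A + M).1)) (fun N => N + (A + M)) v.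
  rewrite -osc1Z //; apply: eq_osc1 => N /=; last by rewrite addrA.
  by rewrite -expfzDr //; congr (q ^ _); ring.
rewrite /osc_e11 /osc_e22 {S1 S2}; move: (osc1 _ _ _ _ v) (osc1 _ _ _ _ v) => S1 S2.
have arrange (x y s1 s2 t t1 t2 : V) : t = t1 + t2 ->
    - (x + t) - (y + s1 + s2) = (- x - y) + (- s2 - t2) - (s1 + t1).
  move=> ->; rewrite !opprD !addrA.
  by rewrite (ACl (1*4*6*3*5*2)).
rewrite linearB linearN (linearZ_LR (Q A)) scalerBr scalerN !scalerDr.
apply: arrange; rewrite !scalerA -scalerDl; congr (_ *: _).
(* The term mu P_(-M) fails to commute with Q_A only for A = - M. Both powers of q are then q^(- M_1
   M_2), and mu splits into the constants mu/2 of e_11 and e_22. *)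
rewrite eq_sym -addr_eq0; case: eqVneq => [AM|_]; last by rewrite !mulr0 addr0.
have -> : A = - M by apply/eqP; rewrite -addr_eq0 AM.
by rewrite /= mulNr mulrN (mulrC M.2) mulr1 -mulrDr; congr (_ * _); field.
Qed.

Lemma osc_e11_vac M v : (forall A, P A v = 0) ->
  osc_e11 M v = - (mu / 2%:R *+ (M == 0)) *: v.
Proof. by move=> Pv; rewrite /osc_e11 osc1_vac // oppr0 add0r scaleNr. Qed.

Lemma osc_e22_vac M v : (forall A, P A v = 0) ->
  osc_e22 M v = (mu / 2%:R *+ (M == 0)) *: v.
Proof. by move=> Pv; rewrite /osc_e22 osc1_vac // add0r. Qed.

Lemma osc_e12_vac M v : (forall A, P A v = 0) -> osc_e12 M v = 0.
Proof. by move=> Pv; rewrite /osc_e12 osc2_vac // Pv scaler0 subr0 oppr0. Qed.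

Lemma osc_deg_vac w v : (forall A, P A v = 0) -> osc_deg w v = 0.
Proof. by move=> Pv; rewrite /osc_deg osc1_vac. Qed.

End OscillatorRealization.

(** * Highest weight modules and their contravariant forms *)

Section HighestWeightModule.
Variables (C : numClosedFieldType) (V : lmodType C).
(* A separating family of linear forms: it turns an identity in V into one in
   C, where ring and field apply. *)
Variables (K : Type) (coord : K -> {scalar V}).
Hypothesis coord_inj : forall u v, (forall k, coord k u = coord k v) -> u = v.
Variables (vac : V) (Q E11 E12 E22 : Z2 -> {linear V -> V}).
Hypothesis Q_ind : forall S : V -> Prop,
  (forall c u v, S u -> S v -> S (c *: u + v)) -> S vac ->
  (forall A v, S v -> S (Q A v)) -> forall v, S v.
Variables q h : C.
Hypothesis q0 : q != 0.
Hypothesis E11_vac : forall M, E11 M vac = - (h *+ (M == 0)) *: vac.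
Hypothesis E22_vac : forall M, E22 M vac = (h *+ (M == 0)) *: vac.
Hypothesis E12_vac : forall M, E12 M vac = 0.
Hypothesis E11_Q : forall M A v,
  E11 M (Q A v) = Q A (E11 M v) - q ^ (A.2 * M.1) *: Q (A + M) v.
Hypothesis E22_Q : forall M A v,
  E22 M (Q A v) = Q A (E22 M v) + q ^ (M.2 * A.1) *: Q (A + M) v.
Hypothesis E12_Q : forall M A v, E12 M (Q A v) = Q A (E12 M v)
  + q ^ (M.2 * A.1) *: E11 (A + M) v - q ^ (A.2 * M.1) *: E22 (A + M) v.
Implicit Types (A B M N : Z2) (u v w : V).

Lemma eq_linear_Q (W : lmodType C) (F G : {linear V -> W}) :
  F vac = G vac -> (forall A v, F v = G v -> F (Q A v) = G (Q A v)) -> F =1 G.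
Proof.
move=> FG1 FGX; apply: Q_ind => // c f g Ff Fg.
by rewrite !linearP Ff Fg.
Qed.

Let linE (W : zmodType) (s : C -> W -> W) (F : {linear V -> W | s}) :
  ((forall u v, F (u + v) = F u + F v)%R * (forall u, F (- u) = - F u)%R
   * (forall c u, F (c *: u) = s c (F u)))%type.
Proof.
by split=> [|c u]; [split; [exact: linearD|exact: linearN]|exact: linearZ_LR].
Qed.

Let pushE := (fun M => linE (Q M), fun M => linE (E11 M), fun M => linE (E12 M),
  fun M => linE (E22 M)).
Let push_coord k := linE (coord k).

Let expE M N : (((M + N).1 = M.1 + N.1)%R * ((M + N).2 = M.2 + N.2)%R)%type.
Proof. by []. Qed.

Let expqD (m n : int) : q ^ (m + n) = q ^ m * q ^ n.
Proof. exact: expfzDr. Qed.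

Ltac vring := apply: coord_inj => k; rewrite ?pushE ?push_coord
  ?(expE, @mulrDl int, @mulrDr int, expqD); ring.

Lemma E11_E11 M N v : E11 M (E11 N v) =
  E11 N (E11 M v) + (q ^ (M.2 * N.1) - q ^ (N.2 * M.1)) *: E11 (M + N) v.
Proof.
apply: (eq_linear_Q (F := E11 M \o E11 N) (G := (E11 N \o E11 M) \+
  (q ^ (M.2 * N.1) - q ^ (N.2 * M.1)) \*: E11 (M + N))) => {v} /= [|A v IH].
  rewrite !(E11_vac, pushE) !scalerA -scalerDl; congr (_ *: _).
  (* On [vac] the bracket term could leave a scalar only for N = - M, and there its two powers of q
     cancel. *)
  case: (eqVneq (M + N) 0) => [/eqP|_]; last by rewrite mulr0n; ring.
  by rewrite addr_eq0 => /eqP ->; rewrite /= !mulNr !mulrN; ring.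
rewrite !(E11_Q, pushE) IH addrA (addrAC A N).
vring.
Qed.

Lemma E22_E22 M N v : E22 M (E22 N v) =
  E22 N (E22 M v) + (q ^ (M.2 * N.1) - q ^ (N.2 * M.1)) *: E22 (M + N) v.
Proof.
apply: (eq_linear_Q (F := E22 M \o E22 N) (G := (E22 N \o E22 M) \+
  (q ^ (M.2 * N.1) - q ^ (N.2 * M.1)) \*: E22 (M + N))) => {v} /= [|A v IH].
  rewrite !(E22_vac, pushE) !scalerA -scalerDl; congr (_ *: _).
  case: (eqVneq (M + N) 0) => [/eqP|_]; last by rewrite mulr0n; ring.
  by rewrite addr_eq0 => /eqP ->; rewrite /= !mulNr !mulrN; ring.
rewrite !(E22_Q, pushE) IH addrA (addrAC A N).
vring.
Qed.

Lemma E11_E22 M N v : E11 M (E22 N v) = E22 N (E11 M v).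
Proof.
apply: (eq_linear_Q (F := E11 M \o E22 N) (G := E22 N \o E11 M))
  => {v} /= [|A v IH].
  by rewrite !(E11_vac, E22_vac, pushE) !scalerA mulrC.
rewrite !(E11_Q, E22_Q, pushE) IH (addrAC A N).
vring.
Qed.

(** Moving [E12] past [Q] creates [E11] and [E22], so the induction step rests on the brackets of
    these with [E11]. *)
Lemma E11_E12 M N v :
  E11 M (E12 N v) = E12 N (E11 M v) + q ^ (M.2 * N.1) *: E12 (M + N) v.
Proof.
apply: (eq_linear_Q (F := E11 M \o E12 N) (G := (E12 N \o E11 M) \+
  q ^ (M.2 * N.1) \*: E12 (M + N))) => {v} /= [|A v IH].
  by rewrite !(E12_vac, E11_vac, pushE, linear0, scaler0) addr0.
rewrite !(E11_Q, E12_Q, pushE) IH E11_E11 E11_E22 !addrA (addrAC A N).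
vring.
Qed.

Lemma E22_E12 M N v :
  E22 M (E12 N v) = E12 N (E22 M v) - q ^ (N.2 * M.1) *: E12 (M + N) v.
Proof.
apply: (eq_linear_Q (F := E22 M \o E12 N) (G := (E12 N \o E22 M) \-
  q ^ (N.2 * M.1) \*: E12 (M + N))) => {v} /= [|A v IH].
  by rewrite !(E12_vac, E22_vac, pushE, linear0, scaler0, addr0).
rewrite !(E22_Q, E12_Q, pushE) IH E22_E22 -E11_E22 !addrA (addrAC A N).
vring.
Qed.

(** After normal ordering past [Q A], the two terms in E_12(A + M + N), one left by [E11] and one by
    [E22], trade places when M and N are swapped. *)
Lemma E12_E12 M N v : E12 M (E12 N v) = E12 N (E12 M v).
Proof.
apply: (eq_linear_Q (F := E12 M \o E12 N) (G := E12 N \o E12 M))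
  => {v} /= [|A v IH].
  by rewrite !(E12_vac, linear0).
rewrite !(E12_Q, pushE) IH !E11_E12 !E22_E12 (addrAC A N).
vring.
Qed.

(** * Degree operators *)

Section Degree.
Variables (w : Z2 -> C) (D : {linear V -> V}).
Hypothesis wD : {morph w : M N / M + N}.
Hypothesis D_vac : D vac = 0.
Hypothesis D_Q : forall A v, D (Q A v) = Q A (D v) + w A *: Q A v.

Let pushD := linE D.

Lemma D_E11 M v : D (E11 M v) = E11 M (D v) + w M *: E11 M v.
Proof.
(* On [vac] the scalar of [E11 M] can be nonzero only for M = 0, and since [D] kills [vac] the
   weight of 0 has to vanish. *)
have w0 : w 0 = 0 by apply: (addrI (w 0)); rewrite -wD !addr0.
apply: (eq_linear_Q (F := D \o E11 M) (G := (E11 M \o D) \+ w M \*: E11 M))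
  => {v} /= [|A v IH].
  rewrite !(E11_vac, D_vac, pushE, pushD, linear0, scaler0) ?add0r ?scalerA.
  by have [->|_] := eqVneq M 0; rewrite ?w0 ?mul0r ?mulr0n ?oppr0 ?mulr0 scale0r.
rewrite !(E11_Q, D_Q, pushE, pushD) IH wD.
vring.
Qed.

Lemma D_E22 M v : D (E22 M v) = E22 M (D v) + w M *: E22 M v.
Proof.
have w0 : w 0 = 0 by apply: (addrI (w 0)); rewrite -wD !addr0.
apply: (eq_linear_Q (F := D \o E22 M) (G := (E22 M \o D) \+ w M \*: E22 M))
  => {v} /= [|A v IH].
  rewrite !(E22_vac, D_vac, pushE, pushD, linear0, scaler0) ?add0r ?scalerA.
  by have [->|_] := eqVneq M 0; rewrite ?w0 ?mul0r ?mulr0n ?mulr0 scale0r.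
rewrite !(E22_Q, D_Q, pushE, pushD) IH wD.
vring.
Qed.

Lemma D_E12 M v : D (E12 M v) = E12 M (D v) + w M *: E12 M v.
Proof.
apply: (eq_linear_Q (F := D \o E12 M) (G := (E12 M \o D) \+ w M \*: E12 M))
  => {v} /= [|A v IH].
  by rewrite !(E12_vac, D_vac, linear0, scaler0) addr0.
rewrite !(E12_Q, D_Q, pushE, pushD) IH !D_E11 !D_E22 wD.
vring.
Qed.

End Degree.

(** The operator B_A: the action of the image of E_21(s^m t^n), A = (m, n), under the
    anti-involution. *)
Definition Qadj A v := - (q ^ (A.2 * A.1) *: E12 (- A) v).

Lemma Qadj_vac A : Qadj A vac = 0.
Proof. by rewrite /Qadj E12_vac scaler0 oppr0. Qed.

Lemma Qadj_is_linear A : linear (Qadj A).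
Proof. by move=> c u v; rewrite /Qadj !pushE; vring. Qed.

Lemma QadjC A B v : Qadj A (Qadj B v) = Qadj B (Qadj A v).
Proof. by rewrite /Qadj !pushE E12_E12; vring. Qed.

(** * Adjoints and symmetry of a form with prescribed adjoints of the Q_A *)

Section Form.
Hypothesis conj_q : q^* = q^-1.
Hypothesis conj_h : h^* = h.
Variable eps : {scalar V}.
Hypothesis eps_vac : eps vac = 1.
Hypothesis eps_Q : forall A v, eps (Q A v) = 0.
Variable form : V -> V -> C.
Hypothesis formPl : forall c u v w, form (c *: u + v) w = c * form u w + form v w.
Hypothesis form_vac : forall w, form vac w = (eps w)^*.
Hypothesis form_Q : forall A v w, form (Q A v) w = form v (Qadj A w).

(** Induction on the first argument: on [vac] the conjugate of the linear [eps] is antilinear, and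
    each [Q A] passes to the second argument as a linear operator. *)
Lemma formPr c u v w : form v (c *: u + w) = c^* * form v u + form v w.
Proof.
move: u w; elim/Q_ind: v => [k v1 v2 IH1 IH2||A v IH] u w.
- by rewrite !formPl IH1 IH2; ring.
- by rewrite !form_vac linearP rmorphD rmorphM.
- by rewrite !form_Q Qadj_is_linear IH.
Qed.

Lemma form0l w : form 0 w = 0.
Proof. by have := formPl (-1) 0 0 w; rewrite scaler0 addr0 mulN1r addNr. Qed.

Lemma form0r v : form v 0 = 0.
Proof.
by have := formPr (-1) 0 v 0; rewrite scaler0 addr0 rmorphN rmorph1 mulN1r addNr.
Qed.

Lemma formDl u v w : form (u + v) w = form u w + form v w.
Proof. by rewrite -{1}[u]scale1r formPl mul1r. Qed.

Lemma formZl c v w : form (c *: v) w = c * form v w.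
Proof. by rewrite -[c *: v]addr0 formPl form0l addr0. Qed.

Lemma formNl v w : form (- v) w = - form v w.
Proof. by rewrite -scaleN1r formZl mulN1r. Qed.

Lemma formDr u v w : form w (u + v) = form w u + form w v.
Proof. by rewrite -{1}[u]scale1r formPr rmorph1 mul1r. Qed.

Lemma formZr c v w : form v (c *: w) = c^* * form v w.
Proof. by rewrite -[c *: w]addr0 formPr form0r addr0. Qed.

Lemma formNr v w : form v (- w) = - form v w.
Proof. by rewrite -scaleN1r formZr rmorphN rmorph1 mulN1r. Qed.

Lemma conj_expq n : (q ^ n)^* = q ^ (- n).
Proof. by rewrite rmorphXz ?unitfE /= ?conj_q ?exprz_inv. Qed.

(** Since q has inverse equal to its conjugate, a power of q enters the second argument with
    opposite exponent. This brings all terms under one form and reduces adjointness to an operator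
    identity. *)
Lemma formZq n v w : q ^ n * form v w = form v (q ^ (- n) *: w).
Proof. by rewrite formZr conj_expq opprK. Qed.

(** [E11 M] sends the image of [Q A] into a sum of images of operators [Q], where [eps] vanishes;
    only the [vac] component counts. *)
Lemma eps_E11 M v : eps (E11 M v) = - (h *+ (M == 0)) * eps v.
Proof.
elim/Q_ind: v => [c u v IHu IHv||A v IH].
- by rewrite !linearP /= IHu IHv; ring.
- by rewrite E11_vac linearZ.
- by rewrite E11_Q linearB linearZ /= !eps_Q !mulr0 subr0.
Qed.

Lemma eps_E22 M v : eps (E22 M v) = (h *+ (M == 0)) * eps v.
Proof.
elim/Q_ind: v => [c u v IHu IHv||A v IH].
- by rewrite !linearP /= IHu IHv; ring.
- by rewrite E22_vac linearZ.
- by rewrite E22_Q linearD linearZ /= !eps_Q !mulr0 addr0.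
Qed.

Ltac vfield := apply: coord_inj => k; rewrite ?pushE ?push_coord
  ?(expE, @mulrDl int, @mulrDr int, @mulNr int, @mulrN int, opprK, opprD, expqD,
    =^~ invr_expz); field; rewrite ?expfz_neq0 //.

(** Induction on [v]: the commutator of [E11 M] with [Q A] is mirrored on the right by the bracket
    of [E11 (- M)] with [E12 (- A)]. *)
Lemma form_E11 M v w :
  form (E11 M v) w = form v (q ^ (M.2 * M.1) *: E11 (- M) w).
Proof.
move: w; elim/Q_ind: v => [c u v IHu IHv||A v IH] w.
- by rewrite linearP !formPl IHu IHv.
- rewrite E11_vac formZl !form_vac linearZ /= eps_E11 oppr_eq0 rmorphM.
  (* Only M = 0 contributes on [vac]; the equality there is the reality of [h]. *)
  have [->|_] := eqVneq M 0.
    by rewrite mulr0 expr0z rmorph1 mul1r mulr1n rmorphM rmorphN /= conj_h.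
  by rewrite mulr0n oppr0 !mul0r rmorph0 mulr0.
rewrite E11_Q formDl formNl formZl !form_Q IH formZq -formNr -formDr; congr form.
rewrite /Qadj !pushE E11_E12 (addrC A) opprD.
vfield.
Qed.

Lemma form_E22 M v w :
  form (E22 M v) w = form v (q ^ (M.2 * M.1) *: E22 (- M) w).
Proof.
move: w; elim/Q_ind: v => [c u v IHu IHv||A v IH] w.
- by rewrite linearP !formPl IHu IHv.
- rewrite E22_vac formZl !form_vac linearZ /= eps_E22 oppr_eq0 rmorphM.
  have [->|_] := eqVneq M 0.
    by rewrite mulr0 expr0z rmorph1 mul1r mulr1n rmorphM /= conj_h.
  by rewrite mulr0n !mul0r rmorph0 mulr0.
rewrite E22_Q formDl formZl !form_Q IH formZq -formDr; congr form.
rewrite /Qadj !pushE E22_E12 (addrC A) opprD.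
vfield.
Qed.

(** On [vac] both sides vanish because [eps] kills the image of [Q]. In the step the commutator with
    [Q A] yields [E11] and [E22], whose adjoints are known, and the right side yields the same
    through [E12_Q]. *)
Lemma form_E12 M v w :
  form (E12 M v) w = form v (- (q ^ (M.2 * M.1) *: Q (- M) w)).
Proof.
move: w; elim/Q_ind: v => [c u v IHu IHv||A v IH] w.
- by rewrite linearP !formPl IHu IHv.
- by rewrite E12_vac form0l form_vac linearN linearZ /= eps_Q mulr0 oppr0 rmorph0.
rewrite E12_Q !formDl formNl !formZl !form_Q IH form_E11 form_E22 !formZq.
rewrite -formNr -!formDr; congr form.
rewrite /Qadj !pushE E12_Q (addrC A) opprD.
vfield.
Qed.

(** The commutator of [D] with [Q A] is w(A) times [Q A], that with [Qadj A] is - w(A) times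
    [Qadj A]; as w(A) is real, [D] is its own adjoint. *)
Lemma form_deg (w : Z2 -> C) (D : {linear V -> V}) :
  {morph w : M N / M + N} -> (forall M, (w M)^* = w M) ->
  D vac = 0 -> (forall A v, D (Q A v) = Q A (D v) + w A *: Q A v) ->
  forall u v, form (D u) v = form u (D v).
Proof.
move=> wD wR D_vac D_Q u; have pushD := linE D.
have w0 : w 0 = 0 by apply: (addrI (w 0)); rewrite -wD !addr0.
have wN M : w (- M) = - w M by apply: (addrI (w M)); rewrite -wD !subrr.
elim/Q_ind: u => [c u v IHu IHv||A u IH] v'.
- by rewrite linearP !formPl IHu IHv.
- rewrite D_vac form0l form_vac; suff -> : eps (D v') = 0 by rewrite rmorph0.
  elim/Q_ind: v' => [c u v IHu IHv||A v IH].
  + by rewrite !linearP /= IHu IHv; ring.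
  + by rewrite D_vac linear0.
  + by rewrite D_Q linearD linearZ /= !eps_Q mulr0 addr0.
rewrite D_Q formDl formZl !form_Q IH -(wR A) -formZr -formDr; congr form.
rewrite /Qadj !pushD (D_E12 wD D_vac D_Q) wN.
vring.
Qed.

(** The adjoint of [Qadj A] is [Q A] again, by [form_E12], so a factor [Q A] can be moved across on
    both sides. What remains is [vac] against any vector, settled by a second induction. *)
Lemma form_sym u v : form u v = (form v u)^*.
Proof.
move: v; elim/Q_ind: u => [c u v IHu IHv||A u IH] w.
- by rewrite formPl formPr IHu IHv rmorphD rmorphM /= conjCK.
- elim/Q_ind: w => [c u v IHu IHv||A v IH].
  + by rewrite formPl formPr IHu IHv rmorphD rmorphM.
  + by rewrite form_vac eps_vac !rmorph1.
  + by rewrite form_Q Qadj_vac form0r form_vac eps_Q.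
rewrite form_Q IH; congr (_^*).
rewrite /Qadj formNl formZl form_E12 formZq -formNr opprK; congr form.
vfield.
Qed.

End Form.

End HighestWeightModule.

(** * Substituting commuting operators for the variables *)

Definition cmseq (m : {cmonom Z2}) : seq Z2 :=
  flatten [seq nseq (m A) A | A <- finsupp m].

(** The monomial [m] evaluated at the operators [B]. The factors come in an arbitrary fixed order,
    immaterial once the [B] commute. *)
HB.lock Definition opmon (W : Type) (B : Z2 -> W -> W) (m : {cmonom Z2}) (w : W) : W :=
  foldr B w (cmseq m).

Section CommutingOperators.
Variables (W : Type) (B : Z2 -> W -> W).
Hypothesis BC : forall A D w, B A (B D w) = B D (B A w).
Implicit Types (A : Z2) (m : {cmonom Z2}) (s t : seq Z2).

Lemma count_cmseq A m : count_mem A (cmseq m) = m A.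
Proof.
rewrite /cmseq count_flatten -map_comp sumnE big_map /=.
under eq_bigr => D _ do rewrite count_nseq.
have [Am|Am] := boolP (A \in finsupp m); last first.
  rewrite big_seq big1 => [|D Dm]; first by apply/esym/eqP; rewrite cmE_eq0.
  by rewrite /=; case: (eqVneq D A) Dm => // ->; rewrite (negbTE Am).
rewrite /= (bigD1_seq A) ?fset_uniq //= eqxx mul1n big1 ?addn0 //.
by move=> D /negbTE ->.
Qed.

Lemma foldrC s t w : foldr B (foldr B w t) s = foldr B (foldr B w s) t.
Proof.
have step A r u : foldr B (B A u) r = B A (foldr B u r).
  by elim: r => //= D r ->; rewrite BC.
by elim: s w => //= A s IH w; rewrite IH step.
Qed.

Lemma foldr_perm s t w : perm_eq s t -> foldr B w s = foldr B w t.
Proof.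
pose S r := foldr B w r = foldr B w s.
(* Permutations are generated by exchanging adjacent blocks, where [foldrC] applies. *)
move=> st; apply/esym; apply: (catCA_perm_ind (P := S) _ st) => // s1 s2 s3.
by rewrite /S !foldr_cat foldrC.
Qed.

Lemma opmon_mulx A m w : opmon B (mulx A m) w = B A (opmon B m w).
Proof.
rewrite opmon.unlock -[RHS]/(foldr B w (A :: cmseq m)); apply: foldr_perm.
by apply/allP => D _ /=; rewrite !count_cmseq mulxE eq_sym.
Qed.

(** The new factor may also act first, as needed when it is handed over to the second argument of a
    pairing. *)
Lemma opmon_mulxr A m w : opmon B (mulx A m) w = opmon B m (B A w).
Proof. by rewrite opmon_mulx opmon.unlock; apply: (foldrC [:: A]). Qed.

Lemma opmon1 w : opmon B mone w = w.
Proof. by rewrite opmon.unlock /cmseq mdom1. Qed.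

End CommutingOperators.

(** * Commuting combinations of derivations and multiplications *)

Section Oscillator.
Variables (C : fieldType) (V : lmodType C) (I : eqType).
Variables (P X : I -> {linear V -> V}) (al ga : I -> C).
Hypothesis PC : forall A B v, P A (P B v) = P B (P A v).
Hypothesis XC : forall A B v, X A (X B v) = X B (X A v).
Hypothesis PX : forall A B v, P A (X B v) = X B (P A v) + (A == B)%:R *: v.

Definition osc A v : V := ga A *: P A v + al A *: X A v.

Lemma osc_is_linear A : linear (osc A).
Proof.
by move=> c u v; rewrite /osc !linearP /= (scalerA _ c) mulrC -scalerA addrACA.
Qed.

Lemma P_osc A B v : P A (osc B v) = osc B (P A v) + (al B *+ (A == B)) *: v.
Proof.
rewrite /osc linearD !(linearZ_LR (P A)) PX PC scalerDr scalerA addrA.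
by rewrite mulr_natr.
Qed.

Lemma oscC A B v : osc A (osc B v) = osc B (osc A v).
Proof.
rewrite -[LHS]/(ga A *: P A (osc B v) + al A *: X A (osc B v)).
rewrite -[RHS]/(ga B *: P B (osc A v) + al B *: X B (osc A v)) !P_osc /osc.
rewrite !(linearD (X _)) !(linearZ_LR (X _)) !scalerDr !scalerA.
rewrite (XC A) (PC A) (eq_sym B) (mulrC (ga B) (ga A)) (mulrC (al B) (al A)).
rewrite (mulrC (ga B) (al A)) (mulrC (al B) (ga A)).
have arrange (x1 x2 x3 x4 t : V) :
    x1 + x2 + t + (x3 + x4) = x1 + x3 + t + (x2 + x4).
  by rewrite !addrA (ACl (1*4*3*2*5)).
rewrite arrange; congr (_ + _ + _ *: _ + _).
(* The two contraction coefficients agree for A = B and both vanish otherwise. *)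
by have [->|_] := eqVneq A B; rewrite // !mulr0n !mulr0.
Qed.

End Oscillator.

HB.lock Definition fosc (C : numClosedFieldType) (al ga : Z2 -> C) (A : Z2) :
  Fock C -> Fock C := osc (@partial C) (@xmul C) al ga A.
(* In terms of the entries of X, (al, ga) = (d, c) gives the map x_A |-> Q_A,
   and (al, ga) = (a, - c) its inverse. *)
HB.lock Definition osc_subst (C : numClosedFieldType) (al ga : Z2 -> C) :
  Fock C -> Fock C := linext (fun m => opmon (fosc al ga) m 1).

Section OscillatorSubstitution.
Variables (C : numClosedFieldType) (al ga : Z2 -> C).
Implicit Types (A B : Z2) (f : Fock C).
Local Notation fosc := (fosc al ga).
Local Notation osc_subst := (osc_subst al ga).

Lemma foscE A f : fosc A f = ga A *: partial A f + al A *: xmul A f.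
Proof. by rewrite fosc.unlock. Qed.

Lemma fosc_is_linear A : linear (fosc A).
Proof. by rewrite unlock; exact: osc_is_linear. Qed.

HB.instance Definition _ A :=
  GRing.isLinear.Build C (Fock C) (Fock C) _ (fosc A) (fosc_is_linear A).

Lemma partial_fosc A B f :
  partial A (fosc B f) = fosc B (partial A f) + (al B *+ (A == B)) *: f.
Proof.
by rewrite fosc.unlock; exact: (P_osc _ _ (@partialC C) (@partial_xmul C)).
Qed.

Lemma foscC A B f : fosc A (fosc B f) = fosc B (fosc A f).
Proof.
rewrite fosc.unlock.
exact: (oscC _ _ (@partialC C) (@xmulC C) (@partial_xmul C)).
Qed.

Lemma osc_subst_is_linear : linear osc_subst.
Proof. by rewrite unlock; exact: linext_is_linear. Qed.

HB.instance Definition _ :=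
  GRing.isLinear.Build C (Fock C) (Fock C) _ osc_subst osc_subst_is_linear.

Lemma osc_subst_mon m : osc_subst (mon m) = opmon fosc m 1.
Proof. by rewrite mon.unlock osc_subst.unlock linextU scale1r. Qed.

Lemma osc_subst1 : osc_subst 1 = 1.
Proof. by rewrite -{1}mon1 osc_subst_mon opmon1. Qed.

Lemma osc_subst_xmul A f : osc_subst (xmul A f) = fosc A (osc_subst f).
Proof.
apply: (@eq_linear_mon _ _ (osc_subst \o @xmul C A) (fosc A \o osc_subst))
  => {f} m /=.
by rewrite xmul_mon !osc_subst_mon opmon_mulx //; apply: foscC.
Qed.

(** Both sides send 1 to 0 and pick up the same delta term when a variable is split off. *)
Lemma osc_subst_partial A f :
  partial A (osc_subst f) = al A *: osc_subst (partial A f).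
Proof.
apply: (@eq_linear_poly _ _ (@partial C A \o osc_subst)
  (al A \*: (osc_subst \o @partial C A))) => {f} /= [|B f IH].
  by rewrite osc_subst1 partial1 linear0 scaler0.
rewrite partial_xmul osc_subst_xmul partial_fosc IH (linearD osc_subst) /=.
rewrite osc_subst_xmul (linearZ_LR osc_subst) (linearZ_LR (fosc B)) scalerDr.
have -> : al B *+ (A == B) = al A * (A == B)%:R.
  by have [->|] := eqVneq A B; rewrite ?mulr1 ?mulr0.
by rewrite -scalerA.
Qed.

End OscillatorSubstitution.

(** * Pairing polynomials with vectors through commuting operators *)

Section Pairing.
Variables (C : numClosedFieldType) (W : Type) (B : Z2 -> W -> W) (phi : W -> C).
Hypothesis BC : forall A D w, B A (B D w) = B D (B A w).

(** Evaluate [f] at the operators [B], with the coefficients of [f] kept outside [phi]: linearity in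
    [f] then holds for any function [phi], in particular for an antilinear one. *)
Definition pairing (f : Fock C) (w : W) : C :=
  linext (V := C^o) (fun m => phi (opmon B m w)) f.

Lemma pairing_linear w : linear (fun f => pairing f w : C^o).
Proof. exact: linext_is_linear. Qed.

Lemma pairing_mon m w : pairing (mon m) w = phi (opmon B m w).
Proof. by rewrite mon.unlock /pairing linextU scale1r. Qed.

Lemma pairing1 w : pairing 1 w = phi w.
Proof. by rewrite -mon1 pairing_mon opmon1. Qed.

Lemma pairing_xmul A f w : pairing (xmul A f) w = pairing f (B A w).
Proof.
pose F w : {linear Fock C -> C^o} := linext (V := C^o) (fun m => phi (opmon B m w)).
apply: (@eq_linear_mon _ _ (F w \o @xmul C A) (F (B A w))) => m /=.
rewrite xmul_mon -[LHS]/(pairing _ _) -[RHS]/(pairing _ _).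
by rewrite !pairing_mon opmon_mulxr.
Qed.

End Pairing.

(** * Oscillator relations for the concrete P_A and Q_A *)

Section FockOperators.
Variables (C : numClosedFieldType) (X : Z2 -> 'M[C]_2).
Hypothesis Xdiag : forall A, X A 0 0 * X A 1 1 = 1.
Implicit Types (A B M N : Z2) (f g : Fock C).

Lemma opPE A f : opP X A f = X A 0 0 *: partial A f.
Proof. by rewrite partial.unlock. Qed.

Lemma opQE A f : opQ X A f = fosc (fun A => X A 1 1) (fun A => X A 1 0) A f.
Proof. by rewrite foscE partial.unlock xmul.unlock. Qed.

Lemma opP_is_linear A : linear (opP X A).
Proof. by move=> c f g; rewrite !opPE linearP scalerDr !scalerA mulrC. Qed.

HB.instance Definition _ A :=
  GRing.isLinear.Build C (Fock C) (Fock C) _ (opP X A) (opP_is_linear A).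

Lemma opQ_is_linear A : linear (opQ X A).
Proof. by move=> c f g; rewrite !opQE linearP. Qed.

HB.instance Definition _ A :=
  GRing.isLinear.Build C (Fock C) (Fock C) _ (opQ X A) (opQ_is_linear A).

Lemma opQC A B f : opQ X A (opQ X B f) = opQ X B (opQ X A f).
Proof. by rewrite !opQE foscC. Qed.

Lemma opPC A B f : opP X A (opP X B f) = opP X B (opP X A f).
Proof.
by rewrite !opPE !(linearZ_LR (partial _)) /= (partialC A) !scalerA mulrC.
Qed.

(** The commutator of P_A and Q_A is a_A d_A, which is 1; the c_A part commutes with P_A. *)
Lemma opPQ A B f : opP X A (opQ X B f) = opQ X B (opP X A f) + (A == B)%:R *: f.
Proof.
have E : X A 0 0 * (X B 1 1 *+ (A == B)) = (A == B)%:R.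
  by have [->|_] := eqVneq A B; rewrite ?mulr0 // mulr1n Xdiag.
rewrite !opPE !opQE partial_fosc scalerDr (linearZ_LR (fosc _ _ B)) /= scalerA.
by rewrite E.
Qed.

Lemma opP_fin f : exists d : {fset Z2}, forall A, A \notin d -> opP X A f = 0.
Proof. by exists (vars f) => A; apply: opP_eq0. Qed.

Lemma opP1 A : opP X A 1 = 0.
Proof. by rewrite opPE partial1 scaler0. Qed.

End FockOperators.

Lemma linear_comb2 (C : nzRingType) (U V : lmodType C) (F : {linear U -> V})
  k l u v : F (k *: u + l *: v) = k *: F u + l *: F v.
Proof. by rewrite linearP linearZ_LR. Qed.

Section FockModule.
Variables (C : numClosedFieldType) (q : C) (X : Z2 -> 'M[C]_2) (mu : C).
Hypothesis q0 : q != 0.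
Hypothesis Xdiag : forall A, X A 0 0 * X A 1 1 = 1.
Implicit Types (A B M N : Z2) (f g : Fock C).

Lemma e11_is_linear M : linear (e11 q X mu M).
Proof. exact: osc_e11_is_linear (@opP_fin _ X) _ _ _. Qed.

Lemma e22_is_linear M : linear (e22 q X mu M).
Proof. exact: osc_e22_is_linear (@opP_fin _ X) _ _ _. Qed.

Lemma e12_is_linear M : linear (e12 q X mu M).
Proof. exact: osc_e12_is_linear (@opPC _ X) (@opP_fin _ X) _ _ _. Qed.

Lemma opD1_is_linear : linear (opD1 X).
Proof. exact: osc1_linear (@opP_fin _ X) _ _. Qed.

Lemma opD2_is_linear : linear (opD2 X).
Proof. exact: osc1_linear (@opP_fin _ X) _ _. Qed.

HB.instance Definition _ M := GRing.isLinear.Build C (Fock C) (Fock C) _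
  (e11 q X mu M) (e11_is_linear M).
HB.instance Definition _ M := GRing.isLinear.Build C (Fock C) (Fock C) _
  (e22 q X mu M) (e22_is_linear M).
HB.instance Definition _ M := GRing.isLinear.Build C (Fock C) (Fock C) _
  (e12 q X mu M) (e12_is_linear M).
HB.instance Definition _ := GRing.isLinear.Build C (Fock C) (Fock C) _
  (opD1 X) opD1_is_linear.
HB.instance Definition _ := GRing.isLinear.Build C (Fock C) (Fock C) _
  (opD2 X) opD2_is_linear.

Lemma e11_opQ M A f :
  e11 q X mu M (opQ X A f) =
  opQ X A (e11 q X mu M f) - q ^ (A.2 * M.1) *: opQ X (A + M) f.
Proof. exact: (osc_e11_Q (opQC X) (opPQ Xdiag) (@opP_fin _ X)). Qed.

Lemma e22_opQ M A f :
  e22 q X mu M (opQ X A f) =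
  opQ X A (e22 q X mu M f) + q ^ (M.2 * A.1) *: opQ X (A + M) f.
Proof.
rewrite mulrC; exact: (osc_e22_Q (opQC X) (opPQ Xdiag) (@opP_fin _ X)).
Qed.

Lemma e12_opQ M A f :
  e12 q X mu M (opQ X A f) = opQ X A (e12 q X mu M f)
  + q ^ (M.2 * A.1) *: e11 q X mu (A + M) f - q ^ (A.2 * M.1) *: e22 q X mu (A + M) f.
Proof. exact: (osc_e12_Q (opQC X) (@opPC _ X) (opPQ Xdiag) (@opP_fin _ X)). Qed.

Lemma opD1_opQ A f : opD1 X (opQ X A f) = opQ X A (opD1 X f) + A.1%:~R *: opQ X A f.
Proof. exact: (osc_deg_Q (opQC X) (opPQ Xdiag) (@opP_fin _ X)). Qed.

Lemma opD2_opQ A f : opD2 X (opQ X A f) = opQ X A (opD2 X f) + A.2%:~R *: opQ X A f.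
Proof. exact: (osc_deg_Q (opQC X) (opPQ Xdiag) (@opP_fin _ X)). Qed.

Lemma e11_1 M : e11 q X mu M 1 = - (mu / 2%:R *+ (M == 0)) *: 1.
Proof. exact: (osc_e11_vac _ _ _ _ (@opP1 _ X)). Qed.

Lemma e22_1 M : e22 q X mu M 1 = (mu / 2%:R *+ (M == 0)) *: 1.
Proof. exact: (osc_e22_vac _ _ _ _ (@opP1 _ X)). Qed.

Lemma e12_1 M : e12 q X mu M 1 = 0.
Proof. exact: (osc_e12_vac _ (@opPC _ X) _ _ _ (@opP1 _ X)). Qed.

Lemma opD1_1 : opD1 X 1 = 0.
Proof. exact: (osc_deg_vac _ _ (@opP1 _ X)). Qed.

Lemma opD2_1 : opD2 X 1 = 0.
Proof. exact: (osc_deg_vac _ _ (@opP1 _ X)). Qed.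

Let a A := X A 0 0.
Let c A := X A 1 0.
Let d A := X A 1 1.
Let cN A := - X A 1 0.

(** The substitution x_A |-> a_A x_A - c_A d/dx_A straightens Q_A into x_A: d/dx_A passes through it
    with a factor a_A, so the derivative terms c_A and - d_A c_A a_A cancel. *)
Lemma osc_subst_opQ A f :
  osc_subst a cN (opQ X A f) = xmul A (osc_subst a cN f).
Proof.
have arrange (V : lmodType C) (u v : V) :
    c A *: u + d A *: (cN A *: (a A *: u) + a A *: v) = v.
  rewrite scalerDr !scalerA addrA -scalerDl mulrAC (mulrC (d A)) Xdiag mul1r.
  by rewrite addrN scale0r add0r scale1r.
rewrite opQE foscE (linear_comb2 (osc_subst a cN)) /= osc_subst_xmul foscE.
by rewrite osc_subst_partial; apply: arrange.
Qed.

Lemma opQ_osc_subst A f :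
  osc_subst d c (xmul A f) = opQ X A (osc_subst d c f).
Proof. by rewrite osc_subst_xmul opQE. Qed.

(** This one-sided inverse makes x_A |-> Q_A surjective, so products of the Q_A applied to 1 span
    all polynomials. *)
Lemma osc_substK f : osc_subst d c (osc_subst a cN f) = f.
Proof.
have arrange (V : lmodType C) (u v w : V) A : u = d A *: w ->
    cN A *: w + a A *: (c A *: u + d A *: v) = v.
  move=> ->; rewrite scalerDr !scalerA addrA -scalerDl mulrAC Xdiag.
  by rewrite mul1r addNr scale0r add0r scale1r.
apply: (@eq_linear_poly _ _ (osc_subst d c \o osc_subst a cN) idfun)
  => {f} /= [|A f IH].
  by rewrite !osc_subst1.
rewrite osc_subst_xmul foscE (linear_comb2 (osc_subst d c)) /=.
rewrite opQ_osc_subst IH opQE foscE; apply: arrange.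
(* The induction hypothesis presents [f] as an image of the substitution, through which its
   derivative is computed. *)
by rewrite -{1}IH osc_subst_partial.
Qed.

Lemma opQ_ind (S : Fock C -> Prop) :
  (forall k f g, S f -> S g -> S (k *: f + g)) -> S 1 ->
  (forall A f, S f -> S (opQ X A f)) -> forall f, S f.
Proof.
move=> SP S1 SQ f; rewrite -[f]osc_substK.
move: (osc_subst a cN f) => {f}.
apply: (fock_ind (S := fun g => S (osc_subst d c g))) => [k f g Sf Sg||A f Sf].
- by rewrite linearP; apply: SP.
- by rewrite osc_subst1.
- by rewrite opQ_osc_subst; apply: SQ.
Qed.

End FockModule.

(** * The contravariant form on the polynomial ring *)

Section FockForm.
Variables (C : numClosedFieldType) (q : C) (X : Z2 -> 'M[C]_2) (mu : C).
Hypothesis q0 : q != 0.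
Hypothesis conj_q : q^* = q^-1.
Hypothesis conj_mu : mu^* = mu.
Hypothesis Xdiag : forall A, X A 0 0 * X A 1 1 = 1.
Implicit Types (A B M N : Z2) (f g : Fock C).

Let Q A : {linear Fock C -> Fock C} := opQ X A.
Let E11 M : {linear Fock C -> Fock C} := e11 q X mu M.
Let E12 M : {linear Fock C -> Fock C} := e12 q X mu M.
Let E22 M : {linear Fock C -> Fock C} := e22 q X mu M.
(** [S] turns products of the Q_A applied to 1 into monomials, so [eps] below is the constant term
    in the basis of these products. *)
Let S : {linear Fock C -> Fock C} :=
  osc_subst (fun A => X A 0 0) (fun A => - X A 1 0).
Let eps : {scalar Fock C} := mcoeff mone \o S.
Let coord (k : {cmonom Z2}) : {scalar Fock C} := mcoeff k.

Let coord_inj f g : (forall k, coord k f = coord k g) -> f = g.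
Proof. by move/malgP. Qed.

Let Qind := opQ_ind Xdiag.

Let eps1 : eps 1 = 1.
Proof. by rewrite /= osc_subst1 mcoeffUU. Qed.

Let eps_Q A f : eps (Q A f) = 0.
Proof.
rewrite /= osc_subst_opQ //; move: (osc_subst _ _ f) => {}f.
apply: (@eq_linear_mon _ _ (mcoeff mone \o @xmul C A : {linear Fock C -> C^o}) \0)
  => {f} m /=.
rewrite xmul_mon mon.unlock mcoeffU; case: eqP => //.
by move/eqP/cmP/(_ A); rewrite mulxE eqxx cm1.
Qed.

Let adjC := QadjC coord_inj Qind q0 (e11_1 q X mu) (e22_1 q X mu) (e12_1 q X mu)
  (e11_opQ q mu Xdiag) (e22_opQ q mu Xdiag) (e12_opQ mu q0 Xdiag).

(** Write [f] as a polynomial in the Q_A applied to 1, replace each Q_A by its prescribed adjoint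
    B_A acting on [g], and pair with 1. *)
Definition fock_form f g : C :=
  pairing (Qadj E12 q) (fun w => (eps w)^*) (S f) g.

Let formPl c f g h :
  fock_form (c *: f + g) h = c * fock_form f h + fock_form g h.
Proof. by rewrite /fock_form linearP pairing_linear. Qed.

Let form_vac g : fock_form 1 g = (eps g)^*.
Proof.
have S1 : S 1 = 1 by exact: osc_subst1.
by rewrite /fock_form S1 pairing1.
Qed.

Let form_Q A f g : fock_form (Q A f) g = fock_form f (Qadj E12 q A g).
Proof.
have SQ : S (Q A f) = xmul A (S f) by exact: osc_subst_opQ.
by rewrite /fock_form SQ; apply: pairing_xmul; apply: adjC.
Qed.

Let conj_h : (mu / 2%:R)^* = mu / 2%:R.
Proof. by rewrite rmorphM /= conj_mu fmorphV /= rmorph_nat. Qed.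

Lemma fock_form_e11 M f g : fock_form (e11 q X mu M f) g =
  fock_form f (q ^ (M.2 * M.1) *: e11 q X mu (- M) g).
Proof.
exact: (form_E11 coord_inj Qind q0 (e11_1 q X mu) (e22_1 q X mu) (e12_1 q X mu)
  (e11_opQ q mu Xdiag) (e22_opQ q mu Xdiag) (e12_opQ mu q0 Xdiag)
  conj_q conj_h eps_Q formPl form_vac form_Q).
Qed.

Lemma fock_form_e22 M f g : fock_form (e22 q X mu M f) g =
  fock_form f (q ^ (M.2 * M.1) *: e22 q X mu (- M) g).
Proof.
exact: (form_E22 coord_inj Qind q0 (e11_1 q X mu) (e22_1 q X mu) (e12_1 q X mu)
  (e11_opQ q mu Xdiag) (e22_opQ q mu Xdiag) (e12_opQ mu q0 Xdiag)
  conj_q conj_h eps_Q formPl form_vac form_Q).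
Qed.

Lemma fock_form_e12 M f g : fock_form (e12 q X mu M f) g =
  fock_form f (- (q ^ (M.2 * M.1) *: opQ X (- M) g)).
Proof.
exact: (form_E12 coord_inj Qind q0 (e11_1 q X mu) (e22_1 q X mu) (e12_1 q X mu)
  (e11_opQ q mu Xdiag) (e22_opQ q mu Xdiag) (e12_opQ mu q0 Xdiag)
  conj_q conj_h eps_Q formPl form_vac form_Q).
Qed.

Lemma fock_form_e21 M f g : fock_form (opQ X M f) g =
  fock_form f (- (q ^ (M.2 * M.1) *: e12 q X mu (- M) g)).
Proof. exact: form_Q. Qed.

Lemma fock_form_opD1 f g : fock_form (opD1 X f) g = fock_form f (opD1 X g).
Proof.
pose w (N : Z2) : C := N.1%:~R.
have wD : {morph w : M N / M + N} by move=> M N; apply: intrD.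
have wR M : (w M)^* = w M by apply: rmorph_int.
exact: (form_deg coord_inj Qind (e11_1 q X mu) (e22_1 q X mu) (e12_1 q X mu)
  (e11_opQ q mu Xdiag) (e22_opQ q mu Xdiag) (e12_opQ mu q0 Xdiag)
  eps_Q formPl form_vac form_Q (D := opD1 X) wD wR (opD1_1 X) (opD1_opQ Xdiag)).
Qed.

Lemma fock_form_opD2 f g : fock_form (opD2 X f) g = fock_form f (opD2 X g).
Proof.
pose w (N : Z2) : C := N.2%:~R.
have wD : {morph w : M N / M + N} by move=> M N; apply: intrD.
have wR M : (w M)^* = w M by apply: rmorph_int.
exact: (form_deg coord_inj Qind (e11_1 q X mu) (e22_1 q X mu) (e12_1 q X mu)
  (e11_opQ q mu Xdiag) (e22_opQ q mu Xdiag) (e12_opQ mu q0 Xdiag)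
  eps_Q formPl form_vac form_Q (D := opD2 X) wD wR (opD2_1 X) (opD2_opQ Xdiag)).
Qed.

Lemma fock_form_sym f g : fock_form f g = (fock_form g f)^*.
Proof.
exact: (form_sym coord_inj Qind q0 (e11_1 q X mu) (e22_1 q X mu) (e12_1 q X mu)
  (e11_opQ q mu Xdiag) (e22_opQ q mu Xdiag) (e12_opQ mu q0 Xdiag)
  conj_q conj_h eps1 eps_Q formPl form_vac form_Q).
Qed.

Lemma fock_form_linearl g : linear (fun f => fock_form f g : C^o).
Proof. by move=> c f h; exact: formPl. Qed.

Lemma fock_form1 : fock_form 1 1 = 1.
Proof. by rewrite form_vac eps1 rmorph1. Qed.

End FockForm.

(** * From generators to the whole Lie algebra *)

Section SesquilinearExtension.
Variables (C : numClosedFieldType) (q : C) (V : lmodType C).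
Variable form : {hermitian V for false & Num.conj}.
Variables f g : V.

(** A coefficient of [x] is conjugated twice on the right, by the anti-involution and by the form,
    and so matches its linear occurrence on the left. *)
Lemma form_linext s (F G : Z2 -> V) (x : qtorus C) :
  (forall M, form (F M) g = form f (s *: (q ^ (M.1 * M.2) *: G (- M)))) ->
  form (linext F x) g = form f (linext G (s *: qbar q x)).
Proof.
move=> FG; rewrite (linearZ_LR (linext G)) /qbar (linear_sum (linext G)) /= scaler_sumr.
rewrite {1}/linext linear_sumlz linear_sumr; apply: eq_bigr => M _.
rewrite linearZl_LR /= FG (linearZ_LR (linext G)) /= linextU.
by rewrite [s *: (_^* *: _)]scalerA (mulrC s) -scalerA [RHS]linearZr_LR /= conjCK.
Qed.

Lemma form_gl (F G : 'I_2 -> 'I_2 -> Z2 -> V) (s t s' t' : V) (a : gl2q C) :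
  (forall i j M, form (F i j M) g =
    form f ((-1) ^+ (i + j)%N *: (q ^ (M.1 * M.2) *: G j i (- M)))) ->
  form s g = form f s' -> form t g = form f t' ->
  form (\sum_(i < 2) \sum_(j < 2) linext (F i j) (entry a i j)
    + coef_ds a *: s + coef_dt a *: t) g =
  form f (\sum_(i < 2) \sum_(j < 2) linext (G i j) (entry (glomega q a) i j)
    + coef_ds (glomega q a) *: s' + coef_dt (glomega q a) *: t').
Proof.
move=> FG st tt; rewrite 2!linearDl 2!linearDr 2!linearZl_LR 2!linearZr_LR /= st tt.
rewrite !conjCK; congr (_ + _ + _).
(* The anti-involution transposes matrix entries, so the two summations change order. *)
rewrite exchange_big linear_sumlz linear_sumr; apply: eq_bigr => j _ /=.
rewrite linear_sumlz linear_sumr; apply: eq_bigr => i _ /=.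
by rewrite entry_omega addnC; apply: form_linext => M; apply: FG.
Qed.

End SesquilinearExtension.

(** Antilinearity in the second argument comes from symmetry. The parameter [false] is the exponent
    of the sign -1, so the sign is + and neither positivity nor nondegeneracy is claimed. *)
Lemma hermitian_of_sym (C : numClosedFieldType) (V : lmodType C) (b : V -> V -> C) :
  (forall c u v w, b (c *: u + v) w = c * b u w + b v w) ->
  (forall u v, b u v = (b v u)^*) ->
  exists form : {hermitian V for false & Num.conj}, forall u v, form u v = b u v.
Proof.
move=> bPl b_sym.
have bPr u c v w : b u (c *: v + w) = c^* * b u v + b u w.
  by rewrite b_sym bPl rmorphD rmorphM /= -!b_sym.
have bil : bilinear_for (GRing.Scale.Law.clone _ _ *%R _)
    (GRing.Scale.Law.clone _ _ (Num.conj \; *%R) _) b.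
  by split=> [w c u v|w c u v] /=; [exact: bPl|exact: bPr].
have herm u v : b u v = (-1) ^+ false * (b v u)^* by rewrite mul1r.
pose bilb := bilinear_isBilinear.Build C V V C _ _ b bil.
pose hermb := isHermitianSesquilinear.Build C V false Num.conj b herm.
by exists (HB.pack_for {hermitian V for false & Num.conj} b bilb hermb).
Qed.

(** * Existence of the contravariant hermitian form *)

Section Main.
Variables (C : numClosedFieldType) (q : C) (X : Z2 -> 'M[C]_2) (mu : C).
Hypothesis q0 : q != 0.
Hypothesis conj_q : q^* = q^-1.
Hypothesis conj_mu : mu^* = mu.
Hypothesis Xdiag : forall A, X A 0 0 * X A 1 1 = 1.

Lemma contravariant_form_exists :
  exists form : {hermitian (Fock C) for false & Num.conj}, contravariant q X mu form.
Proof.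
have [|form formE] := @hermitian_of_sym C (Fock C) (fock_form q X mu) _
  (fock_form_sym q0 conj_q conj_mu Xdiag).
  by move=> c f g h; exact: (fock_form_linearl q X mu h c f g).
exists form; split; first by rewrite formE; exact: fock_form1.
move=> a f g; apply: form_gl; last 2 first.
- by rewrite !formE; exact: fock_form_opD1.
- by rewrite !formE; exact: fock_form_opD2.
have ij (i : 'I_2) : i = 0 \/ i = 1.
  by case: i => [[|[|]]] // ?; [left|right]; apply: val_inj.
move=> i j M; rewrite !formE (mulrC M.1).
case: (ij i) (ij j) => -> [] ->; rewrite /eop /= ?expr0 ?expr1 ?sqrrN ?expr1n.
- rewrite scale1r; exact: fock_form_e11.
- rewrite scaleN1r; exact: fock_form_e12.
- rewrite scaleN1r; exact: fock_form_e21.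
- rewrite scale1r; exact: fock_form_e22.
Qed.

End Main.

Theorem theorem3p6 (R : realType) (q : R[i]) (X : Z2 -> 'M[R[i]]_2)
    (mu : R[i]) (hq : `|q| = 1)
    (hXtrig : forall A : Z2, is_trig_mx (X A))
    (hXdet : forall A : Z2, \det (X A) = 1)
    (hmu : mu \is Num.real) :
  exists form : {hermitian (Fock R[i]) for false & Num.conj},
    contravariant q X mu form.
Proof.
have q0 : q != 0 by rewrite -normr_eq0 hq oner_eq0.
have conj_q : q^* = q^-1 by rewrite invC_norm hq expr1n invr1 mul1r.
have Xdiag A : X A 0 0 * X A 1 1 = 1.
  rewrite -(hXdet A) (det_trig (hXtrig A)) !big_ord_recl big_ord0 mulr1.
  by congr (_ * X A _ _); apply: val_inj.
exact: contravariant_form_exists q0 conj_q (CrealP hmu) Xdiag.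
Qed.
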